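(* For the planar circular restricted three-body problem with $C=3.03$ and $\mu=0.0009537$ there exist infinitely many geometrically different $R$-symmetric periodic orbits.
   Context: The planar circular restricted three-body problem (PCR3BP) is the system $$\ddot x-2\dot y=\Omega_x(x,y),\qquad \ddot y+2\dot x=\Omega_y(x,y),$$ where $\Omega(x,y)=\frac{x^2+y^2}{2}+\frac{1-\mu}{r_1}+\frac{\mu}{r_2}+\frac{\mu(1-\mu)}{2}$, $r_1=\sqrt{(x+\mu)^2+y^2}$, $r_2=\sqrt{(x-1+\mu)^2+y^2}$. It is considered on the level set $\mathcal M=\{(x,y,\dot x,\dot y): -(\dot x^2+\dot y^2)+2\Omega(x,y)=C\}$ of its first integral (the Jacobi integral), with $C=3.03$, $\mu=0.0009537$. Put $R(x,y,\dot x,\dot y)=(x,-y,-\dot x,\dot y)$ (a time-reversing symmetry of the flow). An orbit $t\mapsto u(t)\in\mathbb R^4$, $t\in I$ ($I$ the maximal interval of existence), is $R$-symmetric if $\{u(t): t\in I\}=\{R(u(t)): t\in I\}$. Orbits are geometrically different if their images in phase space are different. *)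

(* Defs.v *)
From Stdlib Require Import Reals Lra.
From Coquelicot Require Import Coquelicot.
Local Open Scope R_scope.

Record state := mkState { px : R; py : R; vx : R; vy : R }.

Definition r1 (mu x y : R) : R := sqrt ((x + mu) ^ 2 + y ^ 2).

Definition r2 (mu x y : R) : R := sqrt ((x - 1 + mu) ^ 2 + y ^ 2).

Definition Omega (mu x y : R) : R :=
  (x ^ 2 + y ^ 2) / 2 + (1 - mu) / r1 mu x y + mu / r2 mu x y
    + mu * (1 - mu) / 2.

Definition Omega_x (mu x y : R) : R := Derive (fun z => Omega mu z y) x.

Definition Omega_y (mu x y : R) : R := Derive (fun z => Omega mu x z) y.

(* Division by zero is total in R, so collisions with the two primaries are
   excluded from the phase space by hand. *)
Definition noncollision (mu : R) (p : state) : Prop :=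
  r1 mu (px p) (py p) <> 0 /\ r2 mu (px p) (py p) <> 0.

Definition level_set (mu C : R) (p : state) : Prop :=
  noncollision mu p /\
  - (vx p ^ 2 + vy p ^ 2) + 2 * Omega mu (px p) (py p) = C.

(* The values of [traj] outside [time] are irrelevant. *)
Record curve := mkCurve { time : R -> Prop; traj : R -> state }.

Definition open_interval (I : R -> Prop) : Prop :=
  (exists t, I t) /\ open I /\
  (forall a b t, I a -> I b -> a <= t <= b -> I t).

Definition solution (mu : R) (o : curve) : Prop :=
  open_interval (time o) /\
  forall t, time o t ->
    let p := traj o t in
    noncollision mu p /\
    is_derive (fun s => px (traj o s)) t (vx p) /\
    is_derive (fun s => py (traj o s)) t (vy p) /\
    is_derive (fun s => vx (traj o s)) t (2 * vy p + Omega_x mu (px p) (py p)) /\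
    is_derive (fun s => vy (traj o s)) t (- 2 * vx p + Omega_y mu (px p) (py p)).

Definition maximal_solution (mu : R) (o : curve) : Prop :=
  solution mu o /\
  forall o' : curve, solution mu o' ->
    (forall t, time o t -> time o' t /\ traj o' t = traj o t) ->
    forall t, time o' t -> time o t.

Definition orbit (mu C : R) (o : curve) : Prop :=
  maximal_solution mu o /\ forall t, time o t -> level_set mu C (traj o t).

Definition image (o : curve) (p : state) : Prop :=
  exists t, time o t /\ p = traj o t.

Definition Rsym (p : state) : state :=
  mkState (px p) (- py p) (- vx p) (vy p).

Definition R_symmetric (o : curve) : Prop :=
  forall p, image o p <-> exists q, image o q /\ p = Rsym q.

(* Equilibria are not periodic orbits. *)
Definition periodic (o : curve) : Prop :=
  (exists T, 0 < T /\
     forall t, time o t -> time o (t + T) /\ traj o (t + T) = traj o t) /\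
  (exists s t, time o s /\ time o t /\ traj o s <> traj o t).

Definition geometrically_different (o o' : curve) : Prop :=
  ~ (forall p, image o p <-> image o' p).

(* Main.v *)
Require Import Defs.
From Stdlib Require Import Reals Lra Psatz Lia Classical ClassicalEpsilon.
From Coquelicot Require Import Coquelicot.
Local Open Scope R_scope.

(** Launch an orbit from [(-s, 0)], opposite to the small primary, perpendicularly
    to the axis and at its pericentre, with the speed prescribed by the Jacobi
    constant; so the launching state is fixed by the symmetry [Rsym]. For
    [s = 1.11] the orbit is an ellipse-like arc that reaches an apocentre
    ([returns_from_111]); for [s = 2] it is hyperbolic and escapes
    ([escapes_from_2]). Let [z] be the first launching point whose orbit does not
    return. It is parabolic: it goes to infinity without exceeding the
    escape velocity. Far away it no longer follows the rotating frame, in which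
    its polar angle therefore decreases to [-oo]. Orbits launched from [s < z]
    close to [z] follow it for a long time and then still have to return, so
    their polar angle at the apocentre tends to [-oo] as [s] tends to [z]
    ([winding]). This angle depends continuously on [s], hence takes all values
    [- n * PI] with [n] large ([return_angles_onto]).

    At an apocentre of angle [- n * PI] the orbit is on the axis and crosses it
    perpendicularly. The orbit is then symmetric about both its launching state
    and its apocentre, which makes it periodic with twice the return time and
    [R]-symmetric. Its least distance to the origin is [s], which tells the
    orbits for different [n] apart.

    No closeness to an integrable case is used; the analysis rests on the
    following. With [qq] the radial velocity times the radius and [Gm] the
    angular momentum in the inertial frame, [qq' = 2 Gm - Cc + UU + ee] on the
    energy level, where [UU] is the potential and [ee] is small; and [Gm' = NN]
    is small because the mass ratio is. As long as [qq] is positive the distance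
    to the origin increases, so no collision can occur before the first
    return. Continuity of the return time needs the return to be transversal,
    which follows from the Jacobi integral alone once the radius exceeds [1.35]
    ([turning_point]); the launched orbits are beyond radius [1.5] by then
    ([clears_early]). The same fact excludes that a non-returning orbit
    accumulates on a circle ([unbounded]).

    The force is modified inside two small discs about the primaries, which the
    orbits in question never enter. The vector field is then globally
    Lipschitz, so that Picard iteration gives solutions for all times. *)

(** * Elementary real analysis *)

Lemma deriv_cont (f : R -> R) (t l : R) : is_derive f t l -> continuity_pt f t.
Proof.
  intros H. apply continuity_pt_filterlim.
  apply (ex_derive_continuous f t). now exists l.
Qed.

Lemma der_eq (f : R -> R) (t a b : R) : is_derive f t a -> a = b -> is_derive f t b.
Proof. now intros H <-. Qed.

Lemma der_const (c t : R) : is_derive (fun _ : R => c) t 0.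
Proof. apply (is_derive_const (K := R_AbsRing) (V := R_NormedModule)). Qed.

Lemma der_id (t : R) : is_derive (fun s : R => s) t 1.
Proof. apply (is_derive_id (K := R_AbsRing)). Qed.

Lemma der_plus (f g : R -> R) (t a b : R) :
  is_derive f t a -> is_derive g t b -> is_derive (fun s => f s + g s) t (a + b).
Proof. apply (is_derive_plus (V := R_NormedModule)). Qed.

Lemma der_minus (f g : R -> R) (t a b : R) :
  is_derive f t a -> is_derive g t b -> is_derive (fun s => f s - g s) t (a - b).
Proof. apply (is_derive_minus (V := R_NormedModule)). Qed.

Lemma der_mult (f g : R -> R) (t a b : R) :
  is_derive f t a -> is_derive g t b ->
  is_derive (fun s => f s * g s) t (a * g t + f t * b).
Proof. intros Hf Hg. apply (is_derive_mult f g t a b Hf Hg). intros; apply Rmult_comm. Qed.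

Lemma der_comp (f g : R -> R) (t a b : R) :
  is_derive f (g t) a -> is_derive g t b -> is_derive (fun s => f (g s)) t (a * b).
Proof.
  intros Hf Hg. apply (der_eq _ _ (b * a)); [| ring]. now apply (is_derive_comp f g).
Qed.

Lemma mvt_ge (f df : R -> R) (a b k : R) :
  a <= b -> (forall t, a <= t <= b -> is_derive f t (df t)) ->
  (forall t, a <= t <= b -> k <= df t) -> k * (b - a) <= f b - f a.
Proof.
  intros Hab Hd Hk.
  destruct (MVT_gen f a b df) as [c [Hc E]].
  - intros x; rewrite Rmin_left, Rmax_right by lra; intros; apply Hd; lra.
  - intros x; rewrite Rmin_left, Rmax_right by lra; intros.
    apply (deriv_cont f x (df x)), Hd; lra.
  - rewrite Rmin_left, Rmax_right in Hc by lra.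
    rewrite E. apply Rmult_le_compat_r; [lra | now apply Hk].
Qed.

Lemma mvt_le (f df : R -> R) (a b k : R) :
  a <= b -> (forall t, a <= t <= b -> is_derive f t (df t)) ->
  (forall t, a <= t <= b -> df t <= k) -> f b - f a <= k * (b - a).
Proof.
  intros Hab Hd Hk.
  assert (H : (- k) * (b - a) <= - f b - - f a).
  { apply (mvt_ge (fun t => - f t) (fun t => - df t)); auto.
    - intros t Ht. apply (is_derive_opp f), Hd, Ht.
    - intros t Ht. specialize (Hk t Ht). lra. }
  lra.
Qed.

Lemma mvt_abs (f df : R -> R) (a b k : R) :
  a <= b -> (forall t, a <= t <= b -> is_derive f t (df t)) ->
  (forall t, a <= t <= b -> Rabs (df t) <= k) -> Rabs (f b - f a) <= k * (b - a).
Proof.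
  intros Hab Hd Hk. apply Rabs_le. split.
  - assert (H := mvt_ge f df a b (- k) Hab Hd).
    enough (- k * (b - a) <= f b - f a) by lra.
    apply H. intros t Ht. specialize (Hk t Ht). apply Rabs_le_between in Hk. lra.
  - apply (mvt_le f df); auto. intros t Ht. specialize (Hk t Ht).
    apply Rabs_le_between in Hk. lra.
Qed.

Lemma mvt_gt (f df : R -> R) (a b : R) :
  a < b -> (forall t, a <= t <= b -> is_derive f t (df t)) ->
  (forall t, a <= t <= b -> 0 < df t) -> f a < f b.
Proof.
  intros Hab Hd Hk.
  destruct (MVT_gen f a b df) as [c [Hc E]].
  - intros x; rewrite Rmin_left, Rmax_right by lra; intros; apply Hd; lra.
  - intros x; rewrite Rmin_left, Rmax_right by lra; intros.
    apply (deriv_cont f x (df x)), Hd; lra.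
  - rewrite Rmin_left, Rmax_right in Hc by lra.
    assert (0 < df c * (b - a)) by (apply Rmult_lt_0_compat; [now apply Hk | lra]).
    lra.
Qed.

Lemma cont_sign_pos (f : R -> R) (t : R) :
  continuity_pt f t -> 0 < f t ->
  exists d, 0 < d /\ forall x, Rabs (x - t) < d -> 0 < f x.
Proof.
  intros Hc Hp. destruct (Hc (f t) Hp) as [d [Hd H]].
  exists d; split; [exact Hd |]. intros x Hx.
  destruct (Req_dec x t) as [-> | Hn]; [exact Hp |].
  assert (K : R_dist (f x) (f t) < f t).
  { apply (H x). split; [split; [exact I | auto] |]. exact Hx. }
  unfold R_dist in K. apply Rabs_lt_between in K. lra.
Qed.

Lemma cont_sign_neg (f : R -> R) (t : R) :
  continuity_pt f t -> f t < 0 ->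
  exists d, 0 < d /\ forall x, Rabs (x - t) < d -> f x < 0.
Proof.
  intros Hc Hp.
  destruct (cont_sign_pos (fun x => - f x) t) as [d [Hd H]].
  - apply continuity_pt_opp. exact Hc.
  - lra.
  - exists d; split; auto. intros x Hx. specialize (H x Hx). lra.
Qed.

(** The zero is the supremum of the times up to which [f] has stayed positive. *)
Lemma first_zero (f : R -> R) (a b : R) :
  a <= b -> (forall t, a <= t <= b -> continuity_pt f t) ->
  0 < f a -> f b <= 0 ->
  exists z, a < z <= b /\ f z = 0 /\ forall t, a <= t < z -> 0 < f t.
Proof.
  intros Hab Hc Ha Hb.
  set (E := fun z => a <= z <= b /\ forall t, a <= t <= z -> 0 < f t).
  destruct (completeness E) as [z [Hub Hlub]].
  - exists b. intros z [Hz _]. lra.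
  - exists a. split; [lra |]. intros t Ht. replace t with a by lra. exact Ha.
  - assert (Haz : a <= z).
    { apply Hub. split; [lra |]. intros t Ht. replace t with a by lra. exact Ha. }
    assert (Hzb : z <= b) by (apply Hlub; intros x [Hx _]; lra).
    assert (Hlt : forall t, a <= t < z -> 0 < f t).
    { intros t Ht. destruct (Rlt_le_dec 0 (f t)) as [|Hn]; [assumption | exfalso].
      assert (z <= t); [| lra].
      apply Hlub. intros x [Hx Hp]. destruct (Rle_lt_dec x t) as [|Hl]; [assumption |].
      specialize (Hp t). lra. }
    assert (Hz0 : f z = 0).
    { destruct (Rtotal_order (f z) 0) as [Hn | [|Hp]]; [exfalso | assumption | exfalso].
      - destruct (cont_sign_neg f z) as [d [Hd H]]; [apply Hc; lra | exact Hn |].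
        destruct (Rle_lt_or_eq_dec a z Haz) as [Hl | Heq].
        + specialize (H (Rmax a (z - d / 2))). specialize (Hlt (Rmax a (z - d / 2))).
          assert (Rmax a (z - d / 2) < z) by (apply Rmax_lub_lt; lra).
          assert (a <= Rmax a (z - d / 2)) by apply Rmax_l.
          assert (z - d / 2 <= Rmax a (z - d / 2)) by apply Rmax_r.
          rewrite Rabs_left in H by lra. lra.
        + rewrite <- Heq in Hn. lra.
      - assert (Hzb' : z < b).
        { destruct (Rle_lt_or_eq_dec z b Hzb) as [|Heq]; [assumption |].
          rewrite Heq in Hp. lra. }
        destruct (cont_sign_pos f z) as [d [Hd H]]; [apply Hc; lra | exact Hp |].
        set (y := Rmin b (z + d / 2)).
        assert (z < y) by (apply Rmin_glb_lt; lra).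
        assert (y <= z + d / 2) by apply Rmin_r.
        assert (y <= b) by apply Rmin_l.
        assert (y <= z); [| lra].
        apply Hub. split; [lra |]. intros t Ht.
        destruct (Rlt_le_dec t z) as [Hl | Hg]; [apply Hlt; lra |].
        apply H. rewrite Rabs_pos_eq; lra. }
    exists z. split; [| split; assumption].
    destruct (Rle_lt_or_eq_dec a z Haz) as [|Heq]; [lra | rewrite <- Heq in Hz0; lra].
Qed.

(** Where the derivative cannot be small, a function that stays positive has a
    positive lower bound: below the threshold it can only move away from zero,
    since once it decreases there it keeps decreasing at a definite rate. *)
Lemma positive_no_stagnation (f df : R -> R) (a c k : R) :
  0 < k -> 0 < c ->
  (forall t, a <= t -> is_derive f t (df t)) ->
  (forall t, a <= t -> continuity_pt df t) ->
  (forall t, a <= t -> 0 < f t) ->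
  (forall t, a <= t -> f t <= c -> k <= Rabs (df t)) ->
  forall t, a <= t -> Rmin (f a) c <= f t.
Proof.
  intros Hk Hc Hd Hcd Hpos Hsl t Ht.
  destruct (Rle_lt_dec (Rmin (f a) c) (f t)) as [|Hlt]; [assumption | exfalso].
  set (m := Rmin (f a) c) in *.
  assert (Hma : m <= f a) by apply Rmin_l.
  assert (Hmc : m <= c) by apply Rmin_r.
  assert (Hdf : exists x, a <= x /\ f x < c /\ df x < 0).
  { (* going back in time from [t], stop when the level [m] is reached *)
    destruct (first_zero (fun x => m - f (- x)) (- t) (- a)) as [z [Hz [Hz0 Hzp]]].
    - lra.
    - intros x Hx. apply continuity_pt_minus; [apply continuity_pt_const; now intros ? ? |].
      apply (continuity_pt_comp Ropp f).
      + apply continuity_pt_opp, continuity_pt_id.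
      + apply (deriv_cont f _ (df (- x))), Hd. lra.
    - rewrite Ropp_involutive. lra.
    - rewrite Ropp_involutive. lra.
    - destruct (MVT_gen f (- z) t df) as [x [Hx E]].
      + intros x; rewrite Rmin_left, Rmax_right by lra; intros; apply Hd; lra.
      + intros x; rewrite Rmin_left, Rmax_right by lra; intros.
        apply (deriv_cont f x (df x)), Hd; lra.
      + rewrite Rmin_left, Rmax_right in Hx by lra.
        assert (Hn : df x < 0).
        { destruct (Rlt_le_dec (df x) 0); [assumption | exfalso].
          assert (0 <= df x * (t - - z)) by (apply Rmult_le_pos; lra). lra. }
        destruct (Req_dec x (- z)) as [-> | Hne].
        * (* the mean value point is the endpoint: move slightly inside *)
          destruct (cont_sign_neg df (- z)) as [d [Hd0 Hdn]]; [apply Hcd; lra | exact Hn |].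
          set (y := Rmin t (- z + d / 2)).
          assert (- z < y) by (apply Rmin_glb_lt; lra).
          assert (y <= - z + d / 2) by apply Rmin_r.
          assert (y <= t) by apply Rmin_l.
          exists y. split; [lra |]. split.
          -- specialize (Hzp (- y)). rewrite Ropp_involutive in Hzp. lra.
          -- apply Hdn. rewrite Rabs_pos_eq; lra.
        * exists x. split; [lra |]. split; [| exact Hn].
          specialize (Hzp (- x)). rewrite Ropp_involutive in Hzp. lra. }
  destruct Hdf as [x [Hax [Hfx Hdx]]].
  (* from [x] on the derivative never reaches zero again *)
  assert (Hneg : forall y, x <= y -> df y < 0).
  { intros y Hy. destruct (Rlt_le_dec (df y) 0) as [|Hg]; [assumption | exfalso].
    destruct (first_zero (fun u => - df u) x y) as [z [Hz [Hz0 Hzp]]].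
    - exact Hy.
    - intros u Hu. apply continuity_pt_opp, Hcd. lra.
    - lra.
    - lra.
    - assert (Hf : f z - f x <= 0 * (z - x)).
      { apply (mvt_le f df); [lra | intros; apply Hd; lra |].
        intros u Hu. destruct (Req_dec u z) as [-> | Hne]; [lra |].
        specialize (Hzp u). lra. }
      specialize (Hsl z). assert (Hz1 : df z = 0) by lra. rewrite Hz1, Rabs_R0 in Hsl. lra. }
  assert (Hrate : forall y, x <= y -> df y <= - k).
  { intros y Hy. specialize (Hneg y Hy) as Hny.
    assert (Hf : f y - f x <= 0 * (y - x)).
    { apply (mvt_le f df); [lra | intros; apply Hd; lra |].
      intros u Hu. specialize (Hneg u). lra. }
    specialize (Hsl y). rewrite Rabs_left in Hsl by lra. lra. }
  set (y := x + f x / k).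
  assert (0 < f x / k) by (apply Rdiv_lt_0_compat; [apply Hpos; lra | lra]).
  assert (Hy : f y - f x <= - k * (y - x)).
  { unfold y. apply (mvt_le f df); [lra | intros; apply Hd; lra |].
    intros u Hu. apply Hrate; lra. }
  replace (- k * (y - x)) with (- f x) in Hy by (unfold y; field; lra).
  specialize (Hpos y). unfold y in *. lra.
Qed.


(** * Global solutions of Lipschitz differential equations *)

Lemma exp_mono (x y : R) : x <= y -> exp x <= exp y.
Proof. intros [H | ->]; [left; now apply exp_increasing | lra]. Qed.

Lemma RInt_exp_bound_pos (f : R -> R) (C K t : R) :
  0 < K -> 0 <= t -> (forall s, continuous f s) ->
  (forall s, Rabs (f s) <= C * exp (K * Rabs s)) ->
  Rabs (RInt f 0 t) <= C / K * exp (K * Rabs t).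
Proof.
  intros HK Ht Hc Hb.
  assert (Hg : is_RInt (fun s => C * exp (K * s)) 0 t
                 (C / K * exp (K * t) - C / K * exp (K * 0))).
  { apply (is_RInt_derive (fun s => C / K * exp (K * s))).
    - intros s _. auto_derive; [exact I |]. field. lra.
    - intros s _. apply (ex_derive_continuous (fun s => C * exp (K * s))).
      auto_derive. exact I. }
  assert (Hf : is_RInt f 0 t (RInt f 0 t)).
  { apply (RInt_correct f). apply (ex_RInt_continuous (V := R_CompleteNormedModule)).
    intros; apply Hc. }
  assert (Hle : forall s, 0 <= s <= t -> norm (f s) <= C * exp (K * s)).
  { intros s Hs. specialize (Hb s). rewrite (Rabs_pos_eq s) in Hb by lra. exact Hb. }
  assert (H := norm_RInt_le f _ 0 t _ _ Ht Hle Hf Hg).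
  change (norm (RInt f 0 t)) with (Rabs (RInt f 0 t)) in H.
  rewrite Rmult_0_r, exp_0 in H. rewrite (Rabs_pos_eq t) by assumption.
  assert (HC : 0 <= C).
  { specialize (Hb 0). rewrite Rabs_R0, Rmult_0_r, exp_0 in Hb.
    pose proof (Rabs_pos (f 0)). lra. }
  assert (0 <= C / K) by (apply Rdiv_le_0_compat; lra). lra.
Qed.

Lemma RInt_exp_bound (f : R -> R) (C K t : R) :
  0 < K -> (forall s, continuous f s) ->
  (forall s, Rabs (f s) <= C * exp (K * Rabs s)) ->
  Rabs (RInt f 0 t) <= C / K * exp (K * Rabs t).
Proof.
  intros HK Hc Hb. destruct (Rle_lt_dec 0 t) as [Ht | Ht].
  - now apply RInt_exp_bound_pos.
  - set (g := fun s => f (- s)).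
    assert (Hg : forall s, continuous g s).
    { intros s. apply (continuous_comp Ropp f); [| apply Hc].
      apply (continuous_opp (V := R_NormedModule)), continuous_id. }
    assert (E : RInt f 0 t = - RInt g 0 (- t)).
    { assert (H := RInt_comp_lin f (-1) 0 0 (- t)).
      replace (-1 * 0 + 0) with 0 in H by ring.
      replace (-1 * - t + 0) with t in H by ring.
      rewrite <- H.
      - rewrite (RInt_scal (V := R_CompleteNormedModule)).
        + change (scal (-1) ?x) with (-1 * x).
          assert (E2 : RInt (fun y => f (-1 * y + 0)) 0 (- t) = RInt g 0 (- t)).
          { apply RInt_ext. intros x _. unfold g. f_equal. lra. }
          rewrite E2. match goal with |- @eq _ ?a ?b => change (@eq R a b) end. ring.
        + apply (ex_RInt_continuous (V := R_CompleteNormedModule)). intros z _.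
          apply (continuous_ext g); [intros y; unfold g; f_equal; ring | apply Hg].
      - apply (ex_RInt_continuous (V := R_CompleteNormedModule)); intros; apply Hc. }
    rewrite E, Rabs_Ropp, <- (Rabs_Ropp t).
    apply RInt_exp_bound_pos; auto; [lra |].
    intros s. unfold g. rewrite <- (Rabs_Ropp s). apply Hb.
Qed.

Lemma integral_derive (f : R -> R) (t : R) (c : R) : (forall s, continuous f s) ->
  is_derive (fun t => c + RInt f 0 t) t (f t).
Proof.
  intros Hf.
  replace (f t) with (plus 0 (f t)) by (unfold plus; simpl; ring).
  apply (is_derive_plus (fun _ => c)); [apply (is_derive_const (K := R_AbsRing) (V := R_NormedModule)) |].
  apply (is_derive_RInt f (fun t => RInt f 0 t) 0 t); [| apply Hf].
  exists (mkposreal 1 Rlt_0_1). intros y _. apply (RInt_correct f).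
  apply (ex_RInt_continuous (V := R_CompleteNormedModule)). intros; apply Hf.
Qed.

(* [ring] cannot read the carrier of a complete normed module off an equation. *)
Ltac ring_R := match goal with |- @eq _ ?a ?b => apply (Rminus_diag_uniq a b) end; ring.

(** The index type is arbitrary: all estimates are uniform in the coordinate, so
    no norm on the phase space is needed. *)
Section Picard.

Context (Idx : Type) (F : (Idx -> R) -> Idx -> R) (L : R) (x0 : Idx -> R) (A : R).
Context (HL : 0 < L).
Context (HLip : forall X Y d, (forall j, Rabs (X j - Y j) <= d) ->
   forall i, Rabs (F X i - F Y i) <= L * d).
Context (HA : forall i, Rabs (F x0 i) <= A).
Context (HC : forall (u : Idx -> R -> R) t, (forall j, continuous (u j) t) ->
   forall i, continuous (fun s => F (fun j => u j s) i) t).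

Fixpoint iter (n : nat) : Idx -> R -> R :=
  match n with
  | O => fun i _ => x0 i
  | S m => fun i t => x0 i + RInt (fun s => F (fun j => iter m j s) i) 0 t
  end.

Lemma iter_cont n : forall i t, continuous (iter n i) t.
Proof.
  induction n as [|n IH]; intros i t; [apply continuous_const |].
  apply (ex_derive_continuous (iter (S n) i)). eexists.
  apply integral_derive. intros s. apply HC. intros; apply IH.
Qed.

Let K := 2 * L.
Let B := A / K.

(** One integration of [L * exp (K * |t|)] with [K = 2 * L] gains the factor one
    half. *)
Lemma iter_step n : forall i t,
  Rabs (iter (S n) i t - iter n i t) <= B / 2 ^ n * exp (K * Rabs t).
Proof.
  assert (HK : 0 < K) by (unfold K; lra).
  induction n as [|n IH]; intros i t.
  - change (iter 1 i t - iter 0 i t) with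
      (x0 i + RInt (fun s => F (fun j => x0 j) i) 0 t - x0 i).
    replace (x0 i + _ - x0 i) with (RInt (fun s => F (fun j => x0 j) i) 0 t) by ring_R.
    replace (B / 2 ^ 0) with (A / K) by (unfold B; simpl; field; lra).
    apply RInt_exp_bound; auto; [intros; apply continuous_const |].
    intros s. specialize (HA i). change (F (fun j => x0 j) i) with (F x0 i).
    pose proof (Rabs_pos (F x0 i)).
    assert (1 <= exp (K * Rabs s)).
    { rewrite <- exp_0. apply exp_mono. apply Rmult_le_pos; [lra | apply Rabs_pos]. }
    nra.
  - set (f := fun s => F (fun j => iter (S n) j s) i).
    set (g := fun s => F (fun j => iter n j s) i).
    assert (Hf : forall s, continuous f s) by (intros; apply HC; intros; apply iter_cont).
    assert (Hg : forall s, continuous g s) by (intros; apply HC; intros; apply iter_cont).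
    assert (E : iter (S (S n)) i t - iter (S n) i t = RInt (fun s => f s - g s) 0 t).
    { change (x0 i + RInt f 0 t - (x0 i + RInt g 0 t) = RInt (fun s => minus (f s) (g s)) 0 t).
      rewrite (RInt_minus (V := R_CompleteNormedModule));
        try (apply (ex_RInt_continuous (V := R_CompleteNormedModule)); auto).
      unfold minus, plus, opp; simpl. ring_R. }
    rewrite E.
    replace (B / 2 ^ S n) with (L * (B / 2 ^ n) / K)
      by (unfold K; simpl; field; split; [apply pow_nonzero; lra | lra]).
    apply RInt_exp_bound; auto.
    + intros s. apply (continuous_minus (V := R_NormedModule)); auto.
    + intros s. rewrite Rmult_assoc. apply HLip. intros j. apply IH.
Qed.

Lemma B_pos (i : Idx) : 0 <= B.
Proof.
  apply Rdiv_le_0_compat; [| unfold K; lra].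
  eapply Rle_trans; [apply Rabs_pos | apply (HA i)].
Qed.

Lemma iter_far i t n k :
  Rabs (iter (k + n) i t - iter n i t) <= 2 * B / 2 ^ n * exp (K * Rabs t) * (1 - / 2 ^ k).
Proof.
  induction k as [|k IH].
  - simpl. replace (iter n i t - iter n i t) with 0 by ring. rewrite Rabs_R0. lra.
  - change (S k + n)%nat with (S (k + n)).
    replace (iter (S (k + n)) i t - iter n i t) with
      ((iter (S (k + n)) i t - iter (k + n) i t) + (iter (k + n) i t - iter n i t))
      by ring.
    eapply Rle_trans; [apply Rabs_triang |].
    assert (H := iter_step (k + n) i t).
    eapply Rle_trans; [apply Rplus_le_compat; [exact H | exact IH] |].
    right. rewrite pow_add. simpl. field. split; apply pow_nonzero; lra.
Qed.

Lemma iter_dist i t n k :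
  Rabs (iter (k + n) i t - iter n i t) <= 2 * B * exp (K * Rabs t) * (/ 2) ^ n.
Proof.
  eapply Rle_trans; [apply iter_far |].
  assert (HB := B_pos i).
  assert (0 < exp (K * Rabs t)) by apply exp_pos.
  assert (0 < / 2 ^ n) by (apply Rinv_0_lt_compat, pow_lt; lra).
  assert (0 < / 2 ^ k) by (apply Rinv_0_lt_compat, pow_lt; lra).
  rewrite pow_inv. unfold Rdiv.
  assert (0 <= 2 * B * exp (K * Rabs t) * / 2 ^ n).
  { apply Rmult_le_pos; [apply Rmult_le_pos |]; lra. }
  nra.
Qed.

Lemma geom_small (C e : R) : 0 < e -> 0 <= C -> exists n, C * (/ 2) ^ n < e.
Proof.
  intros He HCp.
  destruct (pow_lt_1_zero (/ 2)) with (y := e / (C + 1)) as [N HN].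
  - rewrite Rabs_pos_eq; lra.
  - apply Rdiv_lt_0_compat; lra.
  - exists N. specialize (HN N (le_n N)).
    rewrite Rabs_pos_eq in HN by (apply pow_le; lra).
    assert (0 < (/ 2) ^ N) by (apply pow_lt; lra).
    apply (Rmult_lt_compat_l (C + 1)) in HN; [| lra].
    replace ((C + 1) * (e / (C + 1))) with e in HN by (field; lra). nra.
Qed.

Definition sol (i : Idx) (t : R) : R := real (Lim_seq (fun n => iter n i t)).

Lemma iter_lim i t : is_lim_seq (fun n => iter n i t) (sol i t).
Proof.
  apply Lim_seq_correct', ex_lim_seq_cauchy_corr.
  intros e.
  assert (HB := B_pos i).
  destruct (geom_small (2 * (2 * B * exp (K * Rabs t))) e) as [N HN].
  - apply cond_pos.
  - assert (0 < exp (K * Rabs t)) by apply exp_pos. nra.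
  - exists N. intros n m Hn Hm.
    assert (Hd : forall p, (N <= p)%nat ->
      Rabs (iter p i t - iter N i t) <= 2 * B * exp (K * Rabs t) * (/ 2) ^ N).
    { intros p Hp. replace p with ((p - N) + N)%nat by lia. apply iter_dist. }
    replace (iter n i t - iter m i t) with
      ((iter n i t - iter N i t) + - (iter m i t - iter N i t)) by ring.
    eapply Rle_lt_trans; [apply Rabs_triang |]. rewrite Rabs_Ropp.
    specialize (Hd n Hn) as Hdn. specialize (Hd m Hm). simpl in HN. lra.
Qed.

Lemma sol_dist i t n : Rabs (sol i t - iter n i t) <= 2 * B * exp (K * Rabs t) * (/ 2) ^ n.
Proof.
  assert (H : is_lim_seq (fun k => Rabs (iter (k + n) i t - iter n i t))
                (Rabs (sol i t - iter n i t))).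
  { apply (is_lim_seq_abs (fun k => iter (k + n) i t - iter n i t) (sol i t - iter n i t)).
    apply is_lim_seq_minus'; [| apply is_lim_seq_const].
    apply (is_lim_seq_incr_n (fun k => iter k i t)). apply iter_lim. }
  apply (is_lim_seq_le (fun k => Rabs (iter (k + n) i t - iter n i t))
    (fun _ => 2 * B * exp (K * Rabs t) * (/ 2) ^ n)
    (Rabs (sol i t - iter n i t)) (2 * B * exp (K * Rabs t) * (/ 2) ^ n)).
  - intros k. apply iter_dist.
  - exact H.
  - apply is_lim_seq_const.
Qed.

Lemma sol_cont i t : continuous (sol i) t.
Proof.
  apply continuity_pt_filterlim. intros e He.
  assert (HB := B_pos i).
  assert (HK : 0 < K) by (unfold K; lra).
  destruct (geom_small (2 * B * exp (K * (Rabs t + 1))) (e / 3)) as [n Hn].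
  - lra.
  - assert (0 < exp (K * (Rabs t + 1))) by apply exp_pos. nra.
  - assert (Hi : continuity_pt (iter n i) t) by apply continuity_pt_filterlim, iter_cont.
    destruct (Hi (e / 3)) as [d [Hd H]]; [lra |].
    exists (Rmin d 1). split; [apply Rmin_glb_lt; lra |].
    intros x [Hx1 Hx2].
    assert (Hu : forall y, Rabs (y - t) < 1 -> Rabs (sol i y - iter n i y) < e / 3).
    { intros y Hy. eapply Rle_lt_trans; [apply sol_dist |].
      eapply Rle_lt_trans; [| exact Hn].
      apply Rmult_le_compat_r; [apply pow_le; lra |].
      apply Rmult_le_compat_l; [lra |]. apply exp_mono, Rmult_le_compat_l; [lra |].
      replace y with (t + (y - t)) by ring.
      eapply Rle_trans; [apply Rabs_triang |]. lra. }
    assert (Hxt : Rabs (x - t) < Rmin d 1) by exact Hx2.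
    pose proof (Rmin_l d 1) as Hm1. pose proof (Rmin_r d 1) as Hm2.
    assert (Ha := Hu x ltac:(lra)).
    assert (Hb := Hu t ltac:(replace (t - t) with 0 by ring; rewrite Rabs_R0; lra)).
    assert (Hc : Rabs (iter n i x - iter n i t) < e / 3).
    { apply (H x). split; [exact Hx1 |]. simpl. unfold R_dist. lra. }
    change (Rabs (sol i x - sol i t) < e).
    apply Rabs_lt_between in Ha, Hb, Hc. apply Rabs_lt_between. lra.
Qed.

Lemma sol_integral i t : sol i t = x0 i + RInt (fun s => F (fun j => sol j s) i) 0 t.
Proof.
  assert (HB := B_pos i).
  assert (HK : 0 < K) by (unfold K; lra).
  apply Rminus_diag_uniq. apply Rabs_eq_0.
  apply Rle_antisym; [| apply Rabs_pos].
  apply le_epsilon. intros e He. rewrite Rplus_0_l.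
  set (f := fun s => F (fun j => sol j s) i).
  assert (Hf : forall s, continuous f s) by (intros; apply HC; intros; apply sol_cont).
  destruct (geom_small (2 * (2 * B * exp (K * Rabs t))) e) as [n Hn]; [lra | |].
  { assert (0 < exp (K * Rabs t)) by apply exp_pos. nra. }
  set (g := fun s => F (fun j => iter n j s) i).
  assert (Hg : forall s, continuous g s) by (intros; apply HC; intros; apply iter_cont).
  replace (sol i t - (x0 i + RInt f 0 t)) with
    ((sol i t - iter (S n) i t) + RInt (fun s => g s - f s) 0 t).
  2:{ rewrite (RInt_minus (V := R_CompleteNormedModule) g f);
        try (apply (ex_RInt_continuous (V := R_CompleteNormedModule)); auto).
      change (iter (S n) i t) with (x0 i + RInt g 0 t).
      unfold minus, plus, opp; simpl. ring_R. }
  eapply Rle_trans; [apply Rabs_triang |].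
  assert (Hd1 := sol_dist i t (S n)).
  assert (Hd2 : Rabs (RInt (fun s => g s - f s) 0 t)
     <= L * (2 * B * (/ 2) ^ n) / K * exp (K * Rabs t)).
  { apply RInt_exp_bound; auto.
    - intros s. apply (continuous_minus (V := R_NormedModule)); auto.
    - intros s. rewrite Rmult_assoc. apply HLip. intros j.
      rewrite Rabs_minus_sym. eapply Rle_trans; [apply sol_dist |]. right; ring. }
  replace (L * (2 * B * (/ 2) ^ n) / K) with (B * (/ 2) ^ n) in Hd2
    by (unfold K; field; lra).
  rewrite <- tech_pow_Rmult in Hd1.
  change (Rabs (sol i t - iter (S n) i t) + Rabs (RInt (fun s => g s - f s) 0 t) <= e).
  assert (0 <= B * exp (K * Rabs t) * (/ 2) ^ n).
  { apply Rmult_le_pos; [apply Rmult_le_pos; [lra | left; apply exp_pos] |].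
    apply pow_le; lra. }
  nra.
Qed.

(** The Picard iterates contract by the factor one half in the norm weighted by
    [exp (- 2 L |t|)], so they converge for all times at once. *)
Theorem picard_global :
  exists u : Idx -> R -> R, forall i, u i 0 = x0 i /\
    forall t, is_derive (u i) t (F (fun j => u j t) i).
Proof.
  exists sol. intros i. split.
  - rewrite sol_integral. rewrite (RInt_point (V := R_CompleteNormedModule)).
    unfold zero; simpl. ring_R.
  - intros t.
    apply (is_derive_ext (fun t => x0 i + RInt (fun s => F (fun j => sol j s) i) 0 t)).
    + intros s. symmetry. apply sol_integral.
    + apply (integral_derive (fun s => F (fun j => sol j s) i)).
      intros s. apply HC. intros; apply sol_cont.
Qed.

End Picard.

Lemma gronwall (D D' : R -> R) (K : R) :
  (forall t, is_derive D t (D' t)) -> (forall t, Rabs (D' t) <= K * D t) ->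
  forall t, D t <= D 0 * exp (K * Rabs t).
Proof.
  intros HD HB t. destruct (Rle_lt_dec 0 t) as [Ht | Ht].
  - assert (H : D t * exp (- (K * t)) - D 0 * exp (- (K * 0)) <= 0 * (t - 0)).
    { apply (mvt_le (fun s => D s * exp (- (K * s)))
               (fun s => (D' s - K * D s) * exp (- (K * s)))).
      - exact Ht.
      - intros s _. eapply der_eq.
        + apply der_mult; [apply HD |]. auto_derive; [exact I | reflexivity].
        + simpl. ring.
      - intros s _. specialize (HB s). apply Rabs_le_between in HB.
        assert (0 < exp (- (K * s))) by apply exp_pos. nra. }
    rewrite Rmult_0_r, Ropp_0, exp_0 in H. rewrite exp_Ropp in H.
    rewrite Rabs_pos_eq by assumption.
    assert (0 < exp (K * t)) by apply exp_pos.
    apply (Rmult_le_reg_r (/ exp (K * t))); [now apply Rinv_0_lt_compat |].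
    rewrite Rmult_assoc, Rinv_r by lra. lra.
  - assert (H : 0 * (0 - t) <= D 0 * exp (K * 0) - D t * exp (K * t)).
    { apply (mvt_ge (fun s => D s * exp (K * s))
               (fun s => (D' s + K * D s) * exp (K * s))).
      - lra.
      - intros s _. eapply der_eq.
        + apply der_mult; [apply HD |]. auto_derive; [exact I | reflexivity].
        + simpl. ring.
      - intros s _. specialize (HB s). apply Rabs_le_between in HB.
        assert (0 < exp (K * s)) by apply exp_pos. nra. }
    rewrite Rmult_0_r, exp_0 in H. rewrite Rabs_left by assumption.
    replace (K * - t) with (- (K * t)) by ring. rewrite exp_Ropp.
    assert (0 < exp (K * t)) by apply exp_pos.
    apply (Rmult_le_reg_r (exp (K * t))); [assumption |].
    rewrite Rmult_assoc, Rinv_l by lra. lra.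
Qed.


(** * The flow regularised near the primaries *)

Definition mu : R := 0.0009537.

Definition k1 (x y : R) : R := (1 - mu) / Rmax (r1 mu x y) (1 / 10) ^ 3.
Definition k2 (x y : R) : R := mu / Rmax (r2 mu x y) (1 / 10) ^ 3.

(** The accelerations of the three-body problem, with the distances to the
    primaries replaced by at least [1 / 10] in the forces: this makes the vector
    field globally Lipschitz without changing it outside two small discs. *)
Definition accx (p : state) : R :=
  2 * vy p + px p - k1 (px p) (py p) * (px p + mu) - k2 (px p) (py p) * (px p - 1 + mu).
Definition accy (p : state) : R :=
  - 2 * vx p + py p - (k1 (px p) (py p) + k2 (px p) (py p)) * py p.

Definition flow (u : R -> state) : Prop := forall t,
  is_derive (fun s => px (u s)) t (vx (u t)) /\
  is_derive (fun s => py (u s)) t (vy (u t)) /\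
  is_derive (fun s => vx (u s)) t (accx (u t)) /\
  is_derive (fun s => vy (u s)) t (accy (u t)).

Definition within (d : R) (p p' : state) : Prop :=
  Rabs (px p - px p') <= d /\ Rabs (py p - py p') <= d /\
  Rabs (vx p - vx p') <= d /\ Rabs (vy p - vy p') <= d.

Definition inv_dist (a b : R) : R := / Rmax (sqrt (a ^ 2 + b ^ 2)) (1 / 10).

Lemma abs_le_sq (a n : R) : 0 <= n -> a * a <= n * n -> Rabs a <= n.
Proof. intros Hn H. apply Rabs_le. split; nra. Qed.

Lemma inv_dist_range (a b : R) : 0 < inv_dist a b <= 10.
Proof.
  assert (H : 1 / 10 <= Rmax (sqrt (a ^ 2 + b ^ 2)) (1 / 10)) by apply Rmax_r.
  unfold inv_dist. set (m := Rmax _ _) in *. split; [apply Rinv_0_lt_compat; lra |].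
  replace 10 with (/ (1 / 10)) by field. apply Rinv_le_contravar; lra.
Qed.

Lemma norm_triang (a b a' b' d : R) : Rabs (a - a') <= d -> Rabs (b - b') <= d ->
  sqrt (a ^ 2 + b ^ 2) <= sqrt (a' ^ 2 + b' ^ 2) + 2 * d.
Proof.
  intros Ha Hb.
  assert (Hd : 0 <= d) by (eapply Rle_trans; [apply Rabs_pos | exact Ha]).
  set (n := sqrt (a' ^ 2 + b' ^ 2)).
  assert (Hn : 0 <= n) by apply sqrt_pos.
  assert (Hn2 : n * n = a' ^ 2 + b' ^ 2) by (apply sqrt_sqrt; nra).
  assert (Rabs a' <= n) by (apply abs_le_sq; nra).
  assert (Rabs b' <= n) by (apply abs_le_sq; nra).
  rewrite <- (sqrt_square (n + 2 * d)) by lra.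
  apply sqrt_le_1_alt.
  apply Rabs_le_between in Ha, Hb, H, H0.
  set (e := a - a') in *. set (f := b - b') in *.
  replace a with (a' + e) by (unfold e; ring).
  replace b with (b' + f) by (unfold f; ring).
  nra.
Qed.

Lemma inv_dist_lip (a b a' b' d : R) : Rabs (a - a') <= d -> Rabs (b - b') <= d ->
  Rabs (inv_dist a b - inv_dist a' b') <= 2 * d * (inv_dist a b * inv_dist a' b').
Proof.
  intros Ha Hb.
  assert (H1 := norm_triang _ _ _ _ _ Ha Hb).
  assert (H2 : sqrt (a' ^ 2 + b' ^ 2) <= sqrt (a ^ 2 + b ^ 2) + 2 * d).
  { apply norm_triang; rewrite Rabs_minus_sym; assumption. }
  unfold inv_dist.
  set (n := sqrt (a ^ 2 + b ^ 2)) in *. set (n' := sqrt (a' ^ 2 + b' ^ 2)) in *.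
  assert (Hd : 0 <= d) by (eapply Rle_trans; [apply Rabs_pos | exact Ha]).
  assert (HM : Rabs (Rmax n' (1 / 10) - Rmax n (1 / 10)) <= 2 * d).
  { apply Rabs_le. unfold Rmax; do 2 destruct Rle_dec; lra. }
  assert (1 / 10 <= Rmax n (1 / 10)) by apply Rmax_r.
  assert (1 / 10 <= Rmax n' (1 / 10)) by apply Rmax_r.
  set (M := Rmax n (1 / 10)) in *. set (M' := Rmax n' (1 / 10)) in *.
  replace (/ M - / M') with ((M' - M) * (/ M * / M')) by (field; lra).
  assert (0 < / M * / M') by (apply Rmult_lt_0_compat; apply Rinv_0_lt_compat; lra).
  rewrite Rabs_mult, (Rabs_pos_eq (/ M * / M')) by lra.
  apply Rmult_le_compat_r; lra.
Qed.

(** Each component is at most the clamped distance, so one of the three inverse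
    distances absorbs it when the inverse cubes are compared. *)
Lemma attraction_lip (a b a' b' d : R) : Rabs (a - a') <= d -> Rabs (b - b') <= d ->
  Rabs (inv_dist a b ^ 3 * a - inv_dist a' b' ^ 3 * a') <= 7000 * d /\
  Rabs (inv_dist a b ^ 3 * b - inv_dist a' b' ^ 3 * b') <= 7000 * d.
Proof.
  intros Ha Hb.
  assert (Hl := inv_dist_lip _ _ _ _ _ Ha Hb).
  assert (Hi := inv_dist_range a b). assert (Hi' := inv_dist_range a' b').
  assert (Hc : Rabs a' * inv_dist a' b' <= 1 /\ Rabs b' * inv_dist a' b' <= 1).
  { unfold inv_dist. set (n := sqrt (a' ^ 2 + b' ^ 2)).
    assert (Hn : 0 <= n) by apply sqrt_pos.
    assert (Hn2 : n * n = a' ^ 2 + b' ^ 2) by (apply sqrt_sqrt; nra).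
    assert (Rabs a' <= n) by (apply abs_le_sq; nra).
    assert (Rabs b' <= n) by (apply abs_le_sq; nra).
    assert (n <= Rmax n (1 / 10)) by apply Rmax_l.
    assert (1 / 10 <= Rmax n (1 / 10)) by apply Rmax_r.
    split; apply (Rmult_le_reg_r (Rmax n (1 / 10))); try lra;
      rewrite Rmult_assoc, Rinv_l by lra; lra. }
  set (i := inv_dist a b) in *. set (i' := inv_dist a' b') in *.
  assert (Hd : 0 <= d) by (eapply Rle_trans; [apply Rabs_pos | exact Ha]).
  assert (Hcube : Rabs (i ^ 3 - i' ^ 3) <= 6000 * d * i').
  { replace (i ^ 3 - i' ^ 3) with ((i - i') * (i ^ 2 + i * i' + i' ^ 2)) by ring.
    rewrite Rabs_mult, (Rabs_pos_eq (i ^ 2 + i * i' + i' ^ 2)) by nra.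
    assert (i ^ 2 + i * i' + i' ^ 2 <= 300) by nra.
    assert (0 <= i ^ 2 + i * i' + i' ^ 2) by nra.
    apply Rle_trans with (2 * d * (i * i') * 300).
    - apply Rmult_le_compat; auto using Rabs_pos.
    - assert (d * i' * i <= d * i' * 10) by (apply Rmult_le_compat_l; nra). nra. }
  assert (Hi3 : i ^ 3 <= 1000) by (assert (i ^ 2 <= 100) by nra; simpl in *; nra).
  assert (Hi30 : 0 <= i ^ 3) by (apply pow_le; lra).
  assert (Hgen : forall c c', Rabs (c - c') <= d -> Rabs c' * i' <= 1 ->
     Rabs (i ^ 3 * c - i' ^ 3 * c') <= 7000 * d).
  { intros c c' Hcc Hc1.
    replace (i ^ 3 * c - i' ^ 3 * c') with (i ^ 3 * (c - c') + (i ^ 3 - i' ^ 3) * c') by ring.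
    eapply Rle_trans; [apply Rabs_triang |]. rewrite !Rabs_mult, (Rabs_pos_eq (i ^ 3)) by lra.
    assert (i ^ 3 * Rabs (c - c') <= 1000 * d)
      by (apply Rmult_le_compat; auto using Rabs_pos).
    assert (Rabs (i ^ 3 - i' ^ 3) * Rabs c' <= 6000 * d * i' * Rabs c')
      by (apply Rmult_le_compat_r; auto using Rabs_pos).
    assert (6000 * d * (Rabs c' * i') <= 6000 * d * 1) by (apply Rmult_le_compat_l; lra).
    lra. }
  split; apply Hgen; tauto.
Qed.

Lemma k1_eq (x y : R) : k1 x y = (1 - mu) * inv_dist (x + mu) y ^ 3.
Proof. unfold k1, inv_dist, r1. rewrite pow_inv. reflexivity. Qed.

Lemma k2_eq (x y : R) : k2 x y = mu * inv_dist (x - 1 + mu) y ^ 3.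
Proof. unfold k2, inv_dist, r2. rewrite pow_inv. reflexivity. Qed.

Lemma acc_lip (p p' : state) (d : R) : within d p p' ->
  Rabs (accx p - accx p') <= 15000 * d /\ Rabs (accy p - accy p') <= 15000 * d.
Proof.
  destruct p as [x y v w], p' as [x' y' v' w']. intros [Hx [Hy [Hv Hw]]]. simpl in *.
  unfold accx, accy; simpl. rewrite !k1_eq, !k2_eq.
  assert (H1 := attraction_lip (x + mu) y (x' + mu) y' d).
  assert (H2 := attraction_lip (x - 1 + mu) y (x' - 1 + mu) y' d).
  replace (x + mu - (x' + mu)) with (x - x') in H1 by ring.
  replace (x - 1 + mu - (x' - 1 + mu)) with (x - x') in H2 by ring.
  destruct (H1 Hx Hy) as [A1 A2]. destruct (H2 Hx Hy) as [B1 B2]. clear H1 H2.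
  set (i := inv_dist (x + mu) y) in *. set (i' := inv_dist (x' + mu) y') in *.
  set (j := inv_dist (x - 1 + mu) y) in *. set (j' := inv_dist (x' - 1 + mu) y') in *.
  apply Rabs_le_between in A1, A2, B1, B2, Hx, Hy, Hv, Hw.
  split; apply Rabs_le; unfold mu in *; nra.
Qed.

Inductive coord := CX | CY | CVX | CVY.

Definition to_state (X : coord -> R) : state := mkState (X CX) (X CY) (X CVX) (X CVY).

Definition field (X : coord -> R) (i : coord) : R :=
  match i with
  | CX => X CVX | CY => X CVY
  | CVX => accx (to_state X) | CVY => accy (to_state X)
  end.

Lemma field_lip (X Y : coord -> R) (d : R) : (forall j, Rabs (X j - Y j) <= d) ->
  forall i, Rabs (field X i - field Y i) <= 15000 * d.
Proof.
  intros H i.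
  assert (Hd : 0 <= d) by (eapply Rle_trans; [apply Rabs_pos | exact (H CX)]).
  destruct (acc_lip (to_state X) (to_state Y) d) as [A B].
  - repeat split; apply H.
  - destruct i; simpl; try assumption.
    + specialize (H CVX). lra.
    + specialize (H CVY). lra.
Qed.

Lemma field_cont (u : coord -> R -> R) (t : R) : (forall j, continuous (u j) t) ->
  forall i, continuous (fun s => field (fun j => u j s) i) t.
Proof.
  intros Hu i. apply filterlim_locally. intros e.
  assert (He : 0 < e / 15001) by (apply Rdiv_lt_0_compat; [apply cond_pos | lra]).
  assert (Hn : forall j, locally t (fun s => ball (u j t) (e / 15001) (u j s))).
  { intros j. exact (proj1 (filterlim_locally _ _) (Hu j) (mkposreal _ He)). }
  assert (Hall := filter_and _ _ (filter_and _ _ (Hn CX) (Hn CY))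
    (filter_and _ _ (Hn CVX) (Hn CVY))).
  revert Hall. apply filter_imp. intros s [[H1 H2] [H3 H4]].
  assert (Hb : forall j, Rabs (u j s - u j t) <= e / 15001).
  { intros j. left. destruct j; assumption. }
  assert (K := field_lip (fun j => u j s) (fun j => u j t) _ Hb i).
  change (Rabs (field (fun j => u j s) i - field (fun j => u j t) i) < e).
  eapply Rle_lt_trans; [exact K |].
  assert (0 < e) by apply cond_pos. lra.
Qed.

Theorem flow_exists (p : state) : exists u, flow u /\ u 0 = p.
Proof.
  set (x0 := fun i => match i with CX => px p | CY => py p | CVX => vx p | CVY => vy p end).
  set (A := Rabs (field x0 CX) + Rabs (field x0 CY) + Rabs (field x0 CVX) + Rabs (field x0 CVY)).
  destruct (picard_global coord field 15000 x0 A) as [u Hu].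
  - lra.
  - apply field_lip.
  - intros i. unfold A. pose proof (Rabs_pos (field x0 CX)). pose proof (Rabs_pos (field x0 CY)).
    pose proof (Rabs_pos (field x0 CVX)). pose proof (Rabs_pos (field x0 CVY)).
    destruct i; lra.
  - apply field_cont.
  - exists (fun t => to_state (fun j => u j t)). split.
    + intros t. simpl. split; [| split; [| split]].
      * apply (proj2 (Hu CX)).
      * apply (proj2 (Hu CY)).
      * apply (proj2 (Hu CVX)).
      * apply (proj2 (Hu CVY)).
    + unfold to_state. rewrite (proj1 (Hu CX)), (proj1 (Hu CY)), (proj1 (Hu CVX)), (proj1 (Hu CVY)).
      destruct p; reflexivity.
Qed.

Definition dist2 (p p' : state) : R :=
  (px p - px p') * (px p - px p') + (py p - py p') * (py p - py p') +
  (vx p - vx p') * (vx p - vx p') + (vy p - vy p') * (vy p - vy p').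

Lemma dist2_pos (p p' : state) : 0 <= dist2 p p'.
Proof.
  unfold dist2. pose proof (Rle_0_sqr (px p - px p')). pose proof (Rle_0_sqr (py p - py p')).
  pose proof (Rle_0_sqr (vx p - vx p')). pose proof (Rle_0_sqr (vy p - vy p')).
  unfold Rsqr in *. lra.
Qed.

Lemma dist2_within (p p' : state) : within (sqrt (dist2 p p')) p p'.
Proof.
  unfold within, dist2.
  set (a := px p - px p'). set (b := py p - py p').
  set (c := vx p - vx p'). set (e := vy p - vy p').
  assert (H : forall z, z * z <= a * a + b * b + c * c + e * e ->
    Rabs z <= sqrt (a * a + b * b + c * c + e * e)).
  { intros z Hz. rewrite <- (sqrt_Rsqr_abs z). apply sqrt_le_1_alt. exact Hz. }
  repeat split; apply H; nra.
Qed.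

Lemma flow_dist (u u' : R -> state) : flow u -> flow u' -> forall t,
  dist2 (u t) (u' t) <= dist2 (u 0) (u' 0) * exp (120000 * Rabs t).
Proof.
  intros Hu Hu' t.
  apply (gronwall (fun t => dist2 (u t) (u' t)) (fun t =>
     2 * ((px (u t) - px (u' t)) * (vx (u t) - vx (u' t)) +
          (py (u t) - py (u' t)) * (vy (u t) - vy (u' t)) +
          (vx (u t) - vx (u' t)) * (accx (u t) - accx (u' t)) +
          (vy (u t) - vy (u' t)) * (accy (u t) - accy (u' t))))).
  - clear t. intros t. destruct (Hu t) as [A [B [C D]]]. destruct (Hu' t) as [A' [B' [C' D']]].
    unfold dist2. eapply der_eq.
    + apply der_plus; [apply der_plus; [apply der_plus |] |];
        (apply der_mult; apply der_minus; eassumption).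
    + simpl. ring.
  - clear t. intros t.
    set (d := sqrt (dist2 (u t) (u' t))).
    assert (W : within d (u t) (u' t)) by apply dist2_within.
    assert (Hd : d * d = dist2 (u t) (u' t)).
    { apply sqrt_sqrt, dist2_pos. }
    destruct (acc_lip _ _ _ W) as [A B].
    assert (Hd0 : 0 <= d) by apply sqrt_pos.
    rewrite <- Hd.
    destruct W as [W1 [W2 [W3 W4]]].
    assert (M : forall a b k, 0 <= k -> Rabs a <= d -> Rabs b <= k * d -> Rabs (a * b) <= k * (d * d)).
    { intros a b k Hk Ha Hb. rewrite Rabs_mult.
      replace (k * (d * d)) with (d * (k * d)) by ring.
      apply Rmult_le_compat; auto using Rabs_pos. }
    rewrite <- (Rmult_1_l d) in W3, W4.
    assert (M1 := M _ _ 1 Rle_0_1 W1 W3).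
    assert (M2 := M _ _ 1 Rle_0_1 W2 W4).
    rewrite Rmult_1_l in W3, W4.
    assert (Hk : 0 <= 15000) by lra.
    assert (M3 := M _ _ 15000 Hk W3 A).
    assert (M4 := M _ _ 15000 Hk W4 B).
    apply Rabs_le_between in M1, M2, M3, M4.
    assert (0 <= d * d) by nra. apply Rabs_le. lra.
Qed.

Lemma flow_unique (u u' : R -> state) : flow u -> flow u' -> u 0 = u' 0 ->
  forall t, u t = u' t.
Proof.
  intros Hu Hu' H0 t. assert (H := flow_dist u u' Hu Hu' t).
  rewrite H0 in H. replace (dist2 (u' 0) (u' 0)) with 0 in H by (unfold dist2; ring).
  rewrite Rmult_0_l in H.
  assert (W := dist2_within (u t) (u' t)).
  rewrite (sqrt_neg_0 _ H) in W. destruct W as [W1 [W2 [W3 W4]]].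
  apply Rabs_le_between in W1, W2, W3, W4.
  destruct (u t) as [x y v w], (u' t) as [x' y' v' w']. simpl in *.
  f_equal; lra.
Qed.

Lemma flow_shift (u : R -> state) (c : R) : flow u -> flow (fun t => u (t + c)).
Proof.
  intros Hu t. destruct (Hu (t + c)) as [A [B [C D]]].
  assert (S := der_plus _ _ t _ _ (der_id t) (der_const c t)).
  split; [| split; [| split]].
  - eapply der_eq; [exact (der_comp _ _ _ _ _ A S) | ring].
  - eapply der_eq; [exact (der_comp _ _ _ _ _ B S) | ring].
  - eapply der_eq; [exact (der_comp _ _ _ _ _ C S) | ring].
  - eapply der_eq; [exact (der_comp _ _ _ _ _ D S) | ring].
Qed.

Lemma k_sym (x y : R) : k1 x (- y) = k1 x y /\ k2 x (- y) = k2 x y.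
Proof.
  unfold k1, k2, r1, r2. replace ((- y) ^ 2) with (y ^ 2) by ring. split; reflexivity.
Qed.

(** The field is reversed by [Rsym] because the clamped distances are even in
    [y]. *)
Lemma flow_reverse (u : R -> state) (c : R) : flow u -> flow (fun t => Rsym (u (c - t))).
Proof.
  intros Hu t. destruct (Hu (c - t)) as [A [B [C D]]].
  assert (S := der_minus _ _ t _ _ (der_const c t) (der_id t)).
  assert (N : is_derive (fun _ : R => 0) t 0) by apply der_const.
  destruct (k_sym (px (u (c - t))) (py (u (c - t)))) as [K1 K2].
  unfold Rsym, accx, accy. simpl. rewrite K1, K2. split; [| split; [| split]].
  - eapply der_eq; [exact (der_comp _ _ _ _ _ A S) | ring].
  - apply (is_derive_ext (fun s => 0 - py (u (c - s)))); [intros; apply Rminus_0_l |].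
    eapply der_eq; [exact (der_minus _ _ _ _ _ N (der_comp _ _ _ _ _ B S)) | ring].
  - apply (is_derive_ext (fun s => 0 - vx (u (c - s)))); [intros; apply Rminus_0_l |].
    eapply der_eq; [exact (der_minus _ _ _ _ _ N (der_comp _ _ _ _ _ C S)) |].
    unfold accx. ring.
  - eapply der_eq; [exact (der_comp _ _ _ _ _ D S) |]. unfold accy. ring.
Qed.


(** * Radial coordinates *)

(** In rotating polar coordinates [(r, th)], [qq] is [r * r'] and [ll] is
    [r^2 * th']; [Gm] is the angular momentum seen from the inertial frame. *)
Definition rho (p : state) : R := px p * px p + py p * py p.
Definition rr (p : state) : R := sqrt (rho p).
Definition qq (p : state) : R := px p * vx p + py p * vy p.
Definition ll (p : state) : R := px p * vy p - py p * vx p.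
Definition Gm (p : state) : R := ll p + rho p.

Definition d1 (p : state) : R := r1 mu (px p) (py p).
Definition d2 (p : state) : R := r2 mu (px p) (py p).

Definition UU (p : state) : R := (1 - mu) / d1 p + mu / d2 p.

(** How far the potential is from being homogeneous of degree [-1] about the
    origin: the radial force times the radius is [- UU + ee]. *)
Definition ee (p : state) : R :=
  mu * (1 - mu) * ((px p + mu) / d1 p ^ 3 - (px p - 1 + mu) / d2 p ^ 3).

(** The torque of the two primaries about the origin. *)
Definition NN (p : state) : R :=
  mu * (1 - mu) * (py p / d1 p ^ 3 - py p / d2 p ^ 3).

(** The Jacobi constant without the constant term of [Omega]. *)
Definition Cc : R := 3.03 - mu * (1 - mu).

(** The time derivative of [qq] on the energy level, see [der_qq]: the Jacobi
    integral has been used to eliminate the speed. *)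
Definition AA (p : state) : R := 2 * Gm p - Cc + UU p + ee p.

Definition level (p : state) : Prop := vx p * vx p + vy p * vy p = rho p + 2 * UU p - Cc.

Lemma sum_sq_pos (a b : R) : 0 <= a * a + b * b.
Proof. nra. Qed.

Lemma rho_pos p : 0 <= rho p.
Proof. apply sum_sq_pos. Qed.

Lemma rr_pos p : 0 <= rr p.
Proof. apply sqrt_pos. Qed.

Lemma rr_sq p : rr p * rr p = rho p.
Proof. apply sqrt_sqrt, rho_pos. Qed.

Lemma d1_sq p : d1 p * d1 p = (px p + mu) * (px p + mu) + py p * py p.
Proof. unfold d1, r1. rewrite sqrt_sqrt; [ring |]. rewrite <- !Rsqr_pow2. apply sum_sq_pos. Qed.

Lemma d2_sq p : d2 p * d2 p = (px p - 1 + mu) * (px p - 1 + mu) + py p * py p.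
Proof. unfold d2, r2. rewrite sqrt_sqrt; [ring |]. rewrite <- !Rsqr_pow2. apply sum_sq_pos. Qed.

Lemma d1_pos p : 0 <= d1 p.
Proof. apply sqrt_pos. Qed.

Lemma d2_pos p : 0 <= d2 p.
Proof. apply sqrt_pos. Qed.

Lemma px_rr p : - rr p <= px p <= rr p.
Proof.
  apply Rabs_le_between, abs_le_sq; [apply rr_pos |]. rewrite rr_sq. unfold rho. pose proof (Rle_0_sqr (py p)). unfold Rsqr in *. lra.
Qed.

Lemma d1_range p : mu <= rr p -> rr p - mu <= d1 p <= rr p + mu.
Proof.
  intros Hm. assert (H := d1_sq p). assert (Hr := rr_sq p). unfold rho in Hr.
  assert (Hx := px_rr p). assert (H0 := d1_pos p). assert (R0 := rr_pos p).
  unfold mu in *. split; nra.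
Qed.

Lemma d2_range p : 1 - mu <= rr p -> rr p - (1 - mu) <= d2 p <= rr p + (1 - mu).
Proof.
  intros Hm. assert (H := d2_sq p). assert (Hr := rr_sq p). unfold rho in Hr.
  assert (Hx := px_rr p). assert (H0 := d2_pos p). assert (R0 := rr_pos p).
  unfold mu in *. split; nra.
Qed.

Lemma d2_far p : 1.11 <= rr p -> px p <= rr p / 2 -> 1 <= d2 p.
Proof.
  intros Hm Hx. assert (H := d2_sq p). assert (Hr := rr_sq p). unfold rho in Hr.
  assert (H0 := d2_pos p). unfold mu in *. nra.
Qed.

Lemma pull_bound (a b d m : R) : 0 < m -> m <= d -> d * d = a * a + b * b ->
  - / (m * m) <= a / d ^ 3 <= / (m * m).
Proof.
  intros Hm Hd Hs.
  assert (Ha : - d <= a <= d) by (split; nra).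
  assert (H3 : 0 < / d ^ 3) by (apply Rinv_0_lt_compat, pow_lt; lra).
  assert (Hi : d * / d ^ 3 <= / (m * m)).
  { replace (d * / d ^ 3) with (/ (d * d)) by (field; lra).
    apply Rinv_le_contravar; nra. }
  unfold Rdiv. split; nra.
Qed.

Lemma NN_bound (p : state) (m : R) : 0 < m -> m <= d1 p -> m <= d2 p ->
  Rabs (NN p) <= mu * / (m * m).
Proof.
  intros Hm H1 H2. unfold NN.
  assert (B1 := pull_bound (py p) (px p + mu) (d1 p) m Hm H1
    ltac:(rewrite d1_sq; ring)).
  assert (B2 := pull_bound (py p) (px p - 1 + mu) (d2 p) m Hm H2
    ltac:(rewrite d2_sq; ring)).
  assert (P1 : 0 < / d1 p ^ 3) by (apply Rinv_0_lt_compat, pow_lt; lra).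
  assert (P2 : 0 < / d2 p ^ 3) by (apply Rinv_0_lt_compat, pow_lt; lra).
  assert (S : Rabs (py p / d1 p ^ 3 - py p / d2 p ^ 3) <= / (m * m)).
  { (* the two pulls have the same sign, so their difference is below either bound *)
    apply Rabs_le. unfold Rdiv in *. destruct (Rle_lt_dec 0 (py p)).
    - assert (0 <= py p * / d1 p ^ 3) by (apply Rmult_le_pos; lra).
      assert (0 <= py p * / d2 p ^ 3) by (apply Rmult_le_pos; lra). lra.
    - assert (0 <= - py p * / d1 p ^ 3) by (apply Rmult_le_pos; lra).
      assert (0 <= - py p * / d2 p ^ 3) by (apply Rmult_le_pos; lra). lra. }
  rewrite Rabs_mult, (Rabs_pos_eq (mu * (1 - mu))) by (unfold mu; lra).
  assert (0 < / (m * m)) by (apply Rinv_0_lt_compat; nra).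
  assert (Hmu : 0 <= mu * (1 - mu) <= mu) by (unfold mu; lra).
  pose proof (Rabs_pos (py p / d1 p ^ 3 - py p / d2 p ^ 3)).
  apply Rmult_le_compat; lra.
Qed.

Lemma ee_bound (p : state) (m n : R) : 0 < m -> 0 < n -> m <= d1 p -> n <= d2 p ->
  Rabs (ee p) <= mu * (/ (m * m) + / (n * n)).
Proof.
  intros Hm Hn H1 H2. unfold ee.
  assert (B1 := pull_bound (px p + mu) (py p) (d1 p) m Hm H1 (d1_sq p)).
  assert (B2 := pull_bound (px p - 1 + mu) (py p) (d2 p) n Hn H2 (d2_sq p)).
  assert (S : Rabs ((px p + mu) / d1 p ^ 3 - (px p - 1 + mu) / d2 p ^ 3)
                <= / (m * m) + / (n * n)) by (apply Rabs_le; lra).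
  rewrite Rabs_mult, (Rabs_pos_eq (mu * (1 - mu))) by (unfold mu; lra).
  assert (Hmu : 0 <= mu * (1 - mu) <= mu) by (unfold mu; lra).
  pose proof (Rabs_pos ((px p + mu) / d1 p ^ 3 - (px p - 1 + mu) / d2 p ^ 3)).
  apply Rmult_le_compat; lra.
Qed.

Lemma div_le_iff (a b c : R) : 0 < b -> a <= c * b -> a / b <= c.
Proof.
  intros Hb H. apply (Rmult_le_reg_r b); [assumption |].
  unfold Rdiv. rewrite Rmult_assoc, Rinv_l by lra. lra.
Qed.

Lemma le_div_iff (a b c : R) : 0 < b -> c * b <= a -> c <= a / b.
Proof.
  intros Hb H. apply (Rmult_le_reg_r b); [assumption |].
  unfold Rdiv. rewrite Rmult_assoc, Rinv_l by lra. lra.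
Qed.

Lemma UU_lower p : 1.11 <= rr p -> (1 - mu) / (rr p + mu) <= UU p.
Proof.
  intros H. unfold UU.
  assert (H1 := d1_range p ltac:(unfold mu; lra)).
  assert (H2 := d2_range p ltac:(unfold mu; lra)).
  assert (0 <= mu / d2 p) by (apply Rdiv_le_0_compat; unfold mu in *; lra).
  assert ((1 - mu) / (rr p + mu) <= (1 - mu) / d1 p).
  { apply Rmult_le_compat_l; [unfold mu; lra |]. apply Rinv_le_contravar; unfold mu in *; lra. }
  lra.
Qed.

Lemma UU_upper p : 1.11 <= rr p -> UU p <= (1 - mu) / (rr p - mu) + mu / (rr p - 1).
Proof.
  intros H. unfold UU.
  assert (H1 := d1_range p ltac:(unfold mu; lra)).
  assert (H2 := d2_range p ltac:(unfold mu; lra)).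
  apply Rplus_le_compat; apply Rmult_le_compat_l; try (unfold mu; lra);
    apply Rinv_le_contravar; unfold mu in *; lra.
Qed.

Lemma UU_small p : 1.11 <= rr p -> UU p <= 0.92.
Proof.
  intros H. eapply Rle_trans; [apply UU_upper, H |].
  assert ((1 - mu) / (rr p - mu) <= 0.91) by (apply div_le_iff; unfold mu; lra).
  assert (mu / (rr p - 1) <= 0.01) by (apply div_le_iff; unfold mu; lra).
  lra.
Qed.

Lemma UU_range p : 1.35 <= rr p -> 0.998 <= rr p * UU p <= 1.004.
Proof.
  intros H. set (r := rr p) in *.
  assert (L := UU_lower p ltac:(fold r; lra)). assert (M := UU_upper p ltac:(fold r; lra)).
  fold r in L, M. split.
  - assert (0.998 / r <= (1 - mu) / (r + mu)).
    { apply div_le_iff; [lra |].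
      replace ((1 - mu) / (r + mu) * r) with ((1 - mu) * r / (r + mu))
        by (field; unfold mu; lra).
      apply le_div_iff; unfold mu; lra. }
    assert (r * (0.998 / r) <= r * UU p) by (apply Rmult_le_compat_l; lra).
    replace (r * (0.998 / r)) with 0.998 in H1 by (field; lra). lra.
  - assert ((1 - mu) / (r - mu) <= 1 / r).
    { apply div_le_iff; [unfold mu; lra |].
      replace (1 / r * (r - mu)) with ((r - mu) / r) by (field; lra).
      apply le_div_iff; unfold mu; lra. }
    assert (mu / (r - 1) <= 0.004 / r).
    { apply div_le_iff; [lra |].
      replace (0.004 / r * (r - 1)) with (0.004 * (r - 1) / r) by (field; lra).
      apply le_div_iff; unfold mu; lra. }
    assert (r * UU p <= r * (1.004 / r)).
    { apply Rmult_le_compat_l; [lra |].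
      replace (1.004 / r) with (1 / r + 0.004 / r) by (unfold Rdiv; lra). lra. }
    replace (r * (1.004 / r)) with 1.004 in H2 by (field; lra). lra.
Qed.

Lemma ee_range p : 1.35 <= rr p -> Rabs (rr p * ee p) <= 0.0115.
Proof.
  intros H. set (r := rr p) in *.
  assert (H1 := d1_range p ltac:(fold r; unfold mu; lra)).
  assert (H2 := d2_range p ltac:(fold r; unfold mu; lra)).
  fold r in H1, H2.
  assert (B := ee_bound p (r - 0.1) (r - 1) ltac:(lra) ltac:(lra)
    ltac:(unfold mu in *; lra) ltac:(unfold mu in *; lra)).
  rewrite Rabs_mult, (Rabs_pos_eq r) by lra.
  assert (r * / ((r - 0.1) * (r - 0.1)) <= 0.9) by (apply div_le_iff; nra).
  assert (r * / ((r - 1) * (r - 1)) <= 11.05) by (apply div_le_iff; nra).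
  apply (Rmult_le_compat_l r) in B; [| lra].
  unfold mu in *. lra.
Qed.

Lemma radial_tangential p : qq p * qq p + ll p * ll p = rho p * (vx p * vx p + vy p * vy p).
Proof. unfold qq, ll, rho. ring. Qed.

Lemma level_identity p : level p ->
  qq p * qq p + ll p * ll p = rho p * (rho p + 2 * UU p - Cc).
Proof. intros H. rewrite radial_tangential, H. reflexivity. Qed.

(** Where the radial velocity nearly vanishes, the radial acceleration does not.
    For given radius the Jacobi integral leaves two values of the tangential
    velocity [h]. The larger one, [h >= r], makes the centrifugal force dominate.
    For the smaller one, a nonnegative radial acceleration would require [h^2] to
    be almost [1 / r] or more, and then [Cc] would be almost [2 sqrt r + 1 / r] or
    more, which exceeds it for [r >= 1.35]. *)
Lemma turning_point p : level p -> 1.35 <= rr p -> qq p * qq p <= rr p / 1000 ->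
  (ll p < 0 -> AA p <= - / (1000 * rr p)) /\ (0 <= ll p -> / (1000 * rr p) <= AA p).
Proof.
  intros HL Hr Hq.
  assert (E := level_identity p HL).
  assert (HU := UU_range p Hr). assert (He := ee_range p Hr).
  assert (Hrs := rr_sq p).
  unfold AA, Gm.
  set (r := rr p) in *. set (U := UU p) in *. set (e := ee p) in *.
  set (l := ll p) in *. set (q := qq p) in *.
  rewrite <- Hrs in *.
  (* [h] is the tangential velocity in the inertial frame *)
  set (h := l / r + r). set (v := q / r).
  assert (Hl : l = r * h - r * r) by (unfold h; field; lra).
  assert (Hqv : q = r * v) by (unfold v; field; lra).
  assert (Hv : r * (v * v) <= / 1000).
  { rewrite Hqv in Hq. apply (Rmult_le_reg_l r); [lra |]. nra. }
  assert (E2 : v * v + h * h - 2 * r * h + Cc - 2 * U = 0).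
  { rewrite Hl, Hqv in E. apply (Rmult_eq_reg_l (r * r)); [| nra]. nra. }
  replace (2 * (l + r * r) - Cc + U + e) with (2 * r * h - Cc + U + e) by (rewrite Hl; ring).
  apply Rabs_le_between in He.
  assert (HCc : 3.029 <= Cc <= 3.0291) by (unfold Cc, mu; lra).
  assert (Hk : / (1000 * r) = / 1000 * / r) by (field; lra).
  assert (Hir : 0 < / r) by (apply Rinv_0_lt_compat; lra).
  assert (Hirr : r * / r = 1) by (field; lra).
  split; intros Hc.
  - apply Rnot_lt_le. intros Hn. rewrite Hk in Hn.
    assert (Hh1 : h < r).
    { assert (r * h < r * r) by lra. nra. }
    assert (Hh2 : 0.984 <= r * (h * h)).
    { assert (A : U - e - v * v - / 1000 * / r < h * h) by lra.
      assert (r * (U - e - v * v - / 1000 * / r) < r * (h * h))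
        by (apply Rmult_lt_compat_l; lra). nra. }
    assert (HUs : U <= 0.75) by nra.
    assert (Hh0 : 0 < h).
    { assert (0 < 2 * r * h) by nra. nra. }
    (* [a / r] is the lower bound for [h] *)
    set (a := sqrt (0.984 * r)).
    assert (Ha : a * a = 0.984 * r) by (apply sqrt_sqrt; lra).
    assert (Ha0 : 1.1525 <= a).
    { unfold a. rewrite <- (sqrt_square 1.1525) by lra. apply sqrt_le_1_alt. lra. }
    assert (Hah : a <= r * h).
    { apply Rsqr_incr_0_var; [| nra]. unfold Rsqr.
      replace (r * h * (r * h)) with (r * (r * (h * h))) by ring. nra. }
    assert (Har : a <= r * r) by nra.
    (* compare [h^2 - 2 r h] with its value at [a / r] *)
    assert (Hmon : r * r * (h * h - 2 * r * h) <= a * a - 2 * (r * r) * a).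
    { assert (0 <= (r * h - a) * (2 * (r * r) - r * h - a)) by (apply Rmult_le_pos; nra). nra. }
    assert (Hfin : 0 <= r * / 1000 + a * a - 2 * (r * r) * a + r * r * Cc - 2 * 0.998 * r).
    { assert (r * r * (v * v) <= r * / 1000) by nra.
      assert (r * 0.998 <= r * (r * U)) by (apply Rmult_le_compat_l; lra).
      nra. }
    (* divide by [r] and express [r] through [a] *)
    assert (Hpoly : 0 <= / 1000 + 0.984 - 2 * r * a + r * Cc - 2 * 0.998).
    { apply (Rmult_le_reg_l r); [lra |]. rewrite Rmult_0_r. rewrite Ha in Hfin. nra. }
    assert (Hr2 : r = a * a / 0.984) by lra.
    assert (Hp3 : 0 <= -1.011 * 0.984 - 2 * (a * a) * a + a * a * 3.0291).
    { assert (r * Cc <= r * 3.0291) by (apply Rmult_le_compat_l; lra).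
      assert (0 <= -1.011 - 2 * r * a + r * 3.0291) by lra.
      rewrite Hr2 in H0. lra. }
    set (b := a - 1.1525). assert (Hb : 0 <= b) by (unfold b; lra).
    replace a with (b + 1.1525) in Hp3 by (unfold b; ring).
    assert (Hb2 : 0 <= b * b) by (apply Rmult_le_pos; lra).
    assert (Hb3 : 0 <= b * b * b) by (apply Rmult_le_pos; lra).
    lra.
  - assert (Hh : r <= h) by nra.
    assert (HUs : U <= 0.75) by nra.
    assert (Hes : - 0.01 <= e) by nra.
    assert (/ (1000 * r) <= 0.001).
    { rewrite Hk. assert (/ r <= 1) by (rewrite <- Rinv_1; apply Rinv_le_contravar; lra). lra. }
    assert (1.8 <= h * h) by nra. assert (0 <= v * v) by nra. lra.
Qed.


(** * Radial coordinates along the flow *)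

Lemma clear_dist p : 1.11 <= rr p -> 1.1 <= d1 p /\ 0.11 <= d2 p.
Proof.
  intros H. assert (H1 := d1_range p ltac:(unfold mu; lra)).
  assert (H2 := d2_range p ltac:(unfold mu; lra)). unfold mu in *. lra.
Qed.

Lemma clear_k p : 1.11 <= rr p ->
  k1 (px p) (py p) = (1 - mu) / d1 p ^ 3 /\ k2 (px p) (py p) = mu / d2 p ^ 3.
Proof.
  intros H. destruct (clear_dist p H). unfold k1, k2. fold (d1 p). fold (d2 p).
  rewrite !Rmax_left by lra. split; reflexivity.
Qed.

(** The radial part of the attraction would be [- UU] if both primaries were at
    the origin; [ee] accounts for their offsets. *)
Lemma radial_force p : 1.11 <= rr p ->
  px p * accx p + py p * accy p = 2 * ll p + rho p - UU p + ee p.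
Proof.
  intros H. destruct (clear_k p H) as [K1 K2]. destruct (clear_dist p H) as [D1 D2].
  unfold accx, accy. rewrite K1, K2.
  assert (S1 := d1_sq p). assert (S2 := d2_sq p).
  unfold UU, ee, ll, rho.
  replace ((1 - mu) / d1 p) with ((1 - mu) / d1 p ^ 3 * (d1 p * d1 p)) by (field; lra).
  replace (mu / d2 p) with (mu / d2 p ^ 3 * (d2 p * d2 p)) by (field; lra).
  rewrite S1, S2. unfold Rdiv. ring.
Qed.

Lemma torque p : 1.11 <= rr p -> px p * accy p - py p * accx p = - 2 * qq p + NN p.
Proof.
  intros H. destruct (clear_k p H) as [K1 K2].
  unfold accx, accy. rewrite K1, K2. unfold qq, NN, Rdiv. ring.
Qed.

Section AlongFlow.

Context (u : R -> state) (Hu : flow u).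

Lemma der_rho t : is_derive (fun s => rho (u s)) t (2 * qq (u t)).
Proof.
  destruct (Hu t) as [A [B _]]. unfold rho. eapply der_eq.
  - apply der_plus; apply der_mult; eassumption.
  - unfold qq. simpl. ring.
Qed.

Lemma der_qq_raw t : is_derive (fun s => qq (u s)) t
  (vx (u t) * vx (u t) + vy (u t) * vy (u t) + (px (u t) * accx (u t) + py (u t) * accy (u t))).
Proof.
  destruct (Hu t) as [A [B [C D]]]. unfold qq. eapply der_eq.
  - apply der_plus; apply der_mult; eassumption.
  - simpl. ring.
Qed.

Lemma der_qq t : 1.11 <= rr (u t) -> level (u t) ->
  is_derive (fun s => qq (u s)) t (AA (u t)).
Proof.
  intros H L. eapply der_eq; [apply der_qq_raw |].
  rewrite (radial_force _ H). unfold level in L. unfold AA, Gm. lra.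
Qed.

Lemma der_ll_raw t : is_derive (fun s => ll (u s)) t
  (px (u t) * accy (u t) - py (u t) * accx (u t)).
Proof.
  destruct (Hu t) as [A [B [C D]]]. unfold ll. eapply der_eq.
  - apply der_minus; apply der_mult; eassumption.
  - simpl. ring.
Qed.

Lemma der_Gm t : 1.11 <= rr (u t) -> is_derive (fun s => Gm (u s)) t (NN (u t)).
Proof.
  intros H. unfold Gm. eapply der_eq.
  - apply der_plus; [apply der_ll_raw | apply der_rho].
  - rewrite (torque _ H). ring.
Qed.

Lemma der_rr t : 0 < rr (u t) -> is_derive (fun s => rr (u s)) t (qq (u t) / rr (u t)).
Proof.
  intros H. unfold rr in *.
  assert (Hp : 0 < rho (u t)).
  { destruct (Rle_lt_dec (rho (u t)) 0); [| assumption].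
    rewrite sqrt_neg_0 in H by assumption. lra. }
  assert (0 < sqrt (rho (u t))) by (now apply sqrt_lt_R0).
  eapply der_eq; [exact (is_derive_sqrt _ _ _ (der_rho t) Hp) |].
  cbv beta. unfold rr. field. lra.
Qed.

Definition jac (p : state) : R := vx p * vx p + vy p * vy p - rho p - 2 * UU p.

Lemma der_inv_d (d a b da db : R -> R) t :
  (forall s, d s = sqrt (a s * a s + b s * b s)) -> 0 < d t ->
  is_derive a t (da t) -> is_derive b t (db t) ->
  is_derive (fun s => / d s) t (- (a t * da t + b t * db t) / d t ^ 3).
Proof.
  intros Hd Hp Ha Hb.
  assert (Hq : 0 < a t * a t + b t * b t).
  { destruct (Rle_lt_dec (a t * a t + b t * b t) 0); [| assumption].
    rewrite Hd, sqrt_neg_0 in Hp by assumption. lra. }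
  apply (is_derive_ext (fun s => / sqrt (a s * a s + b s * b s))); [now intros s; rewrite Hd |].
  assert (Hs : is_derive (fun s => a s * a s + b s * b s) t
    (da t * a t + a t * da t + (db t * b t + b t * db t)))
    by (apply der_plus; apply der_mult; assumption).
  assert (Hr := is_derive_sqrt _ _ _ Hs Hq).
  rewrite Hd in Hp.
  eapply der_eq; [exact (is_derive_inv _ _ _ Hr ltac:(simpl; lra)) |].
  cbv beta. rewrite Hd. field. lra.
Qed.

Lemma der_jac t : 1.11 <= rr (u t) -> is_derive (fun s => jac (u s)) t 0.
Proof.
  intros H. destruct (clear_k _ H) as [K1 K2]. destruct (clear_dist _ H) as [D1 D2].
  destruct (Hu t) as [A [B [C D]]].
  assert (I1 : is_derive (fun s => / d1 (u s)) t
     (- ((px (u t) + mu) * vx (u t) + py (u t) * vy (u t)) / d1 (u t) ^ 3)).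
  { apply (der_inv_d (fun s => d1 (u s)) (fun s => px (u s) + mu) (fun s => py (u s))
      (fun s => vx (u s)) (fun s => vy (u s))); try assumption; try lra.
    - intros s. unfold d1, r1. f_equal. ring.
    - eapply der_eq; [apply der_plus; [exact A | apply der_const] | cbv beta; ring]. }
  assert (I2 : is_derive (fun s => / d2 (u s)) t
     (- ((px (u t) - 1 + mu) * vx (u t) + py (u t) * vy (u t)) / d2 (u t) ^ 3)).
  { apply (der_inv_d (fun s => d2 (u s)) (fun s => px (u s) - 1 + mu) (fun s => py (u s))
      (fun s => vx (u s)) (fun s => vy (u s))); try assumption; try lra.
    - intros s. unfold d2, r2. f_equal. ring.
    - eapply der_eq; [apply der_plus; [apply der_minus; [exact A |] |]; apply der_const | cbv beta; ring]. }
  unfold jac, UU, Rdiv. eapply der_eq.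
  - apply der_minus; [apply der_minus; [apply der_plus; apply der_mult; eassumption | apply der_rho] |].
    apply der_mult; [apply der_const |].
    apply der_plus; (apply der_mult; [apply der_const | eassumption]).
  - cbv beta. unfold accx, accy. rewrite K1, K2. unfold qq, Rdiv. ring.
Qed.

(** Conservation of the Jacobi integral as long as the orbit stays away from
    the discs where the force has been modified. *)
Lemma level_conserved a b : a <= b -> level (u a) ->
  (forall t, a <= t <= b -> 1.11 <= rr (u t)) -> forall t, a <= t <= b -> level (u t).
Proof.
  intros Hab L H t Ht.
  assert (E : Rabs (jac (u t) - jac (u a)) <= 0 * (t - a)).
  { apply (mvt_abs (fun s => jac (u s)) (fun _ => 0)); [lra | |].
    - intros s Hs. apply der_jac, H. lra.
    - intros s _. rewrite Rabs_R0. lra. }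
  rewrite Rmult_0_l in E. apply Rabs_le_between in E.
  unfold level, jac in *. lra.
Qed.

Lemma rr_mono a b : a <= b -> (forall t, a <= t <= b -> 0 <= qq (u t)) -> rr (u a) <= rr (u b).
Proof.
  intros Hab Hq. apply sqrt_le_1_alt.
  assert (H : 0 * (b - a) <= rho (u b) - rho (u a)).
  { apply (mvt_ge (fun s => rho (u s)) (fun s => 2 * qq (u s))); [assumption | |].
    - intros; apply der_rho.
    - intros t Ht. specialize (Hq t Ht). lra. }
  lra.
Qed.

(** On an outgoing arc the distance increases, so nothing can come near the
    primaries and the Jacobi integral is conserved. *)
Lemma outgoing a b : a <= b -> 1.11 <= rr (u a) -> level (u a) ->
  (forall t, a <= t <= b -> 0 <= qq (u t)) ->
  forall t, a <= t <= b -> rr (u a) <= rr (u t) /\ level (u t).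
Proof.
  intros Hab Hr L Hq.
  assert (M : forall t, a <= t <= b -> rr (u a) <= rr (u t)).
  { intros t Ht. apply rr_mono; [lra |]. intros; apply Hq; lra. }
  intros t Ht. split; [now apply M |].
  apply (level_conserved a b); auto. intros s Hs. specialize (M s Hs). lra.
Qed.

Lemma cont_qq t : continuity_pt (fun s => qq (u s)) t.
Proof. eapply deriv_cont, der_qq_raw. Qed.

Lemma cont_ll t : continuity_pt (fun s => ll (u s)) t.
Proof. eapply deriv_cont, der_ll_raw. Qed.

Lemma cont_rho t : continuity_pt (fun s => rho (u s)) t.
Proof. eapply deriv_cont, der_rho. Qed.

(** An outgoing orbit above the escape velocity never turns back:
    [qq^2 / (2 rho) - 11 / 10 / rr], an energy for a slightly too strong central
    attraction and no centrifugal force, can only increase. *)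
Lemma escape a : 1.35 <= rr (u a) -> level (u a) -> 0 < qq (u a) ->
  11 / 5 * rr (u a) < qq (u a) * qq (u a) -> forall t, a <= t -> 0 < qq (u t).
Proof.
  intros Hr L Hq Hesc t Ht.
  destruct (Rlt_le_dec 0 (qq (u t))) as [|Hn]; [assumption | exfalso].
  destruct (first_zero (fun s => qq (u s)) a t) as [z [Hz [Hz0 Hzp]]]; auto.
  { intros; apply cont_qq. }
  assert (Hpos : forall s, a <= s <= z -> 0 <= qq (u s)).
  { intros s Hs. destruct (Req_dec s z) as [-> |]; [lra |]. left. apply Hzp. lra. }
  assert (O := outgoing a z ltac:(lra) ltac:(lra) L Hpos).
  set (W := fun s => qq (u s) / rr (u s) * (qq (u s) / rr (u s)) / 2 - 11 / 10 * / rr (u s)).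
  set (W' := fun s => qq (u s) / rr (u s) *
     ((AA (u s) * rr (u s) - qq (u s) * (qq (u s) / rr (u s))) / (rr (u s) * rr (u s))
       + 11 / 10 / (rr (u s) * rr (u s)))).
  assert (HW : 0 * (z - a) <= W z - W a).
  { apply (mvt_ge W W'); [lra | |].
    - intros s Hs. destruct (O s Hs) as [Or Ol].
      assert (Ri : is_derive (fun s => / rr (u s)) s (- (qq (u s) / rr (u s)) / (rr (u s) * rr (u s)))).
      { assert (Hp : 0 < rr (u s)) by lra.
        eapply der_eq; [exact (is_derive_inv _ _ _ (der_rr s Hp) ltac:(simpl; lra)) |].
        simpl. field. lra. }
      unfold W, Rdiv at 1 2 3. eapply der_eq.
      + apply der_minus.
        * apply der_mult; [| apply der_const].
          apply der_mult; (apply der_mult; [apply der_qq; [lra | assumption] | exact Ri]).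
        * apply der_mult; [apply der_const | exact Ri].
      + unfold W'. simpl. field. lra.
    - intros s Hs. destruct (O s Hs) as [Or Ol]. unfold W'.
      set (r := rr (u s)) in *. set (q := qq (u s)) in *.
      assert (Hqs : 0 <= q) by (apply Hpos; assumption).
      assert (HU := UU_range (u s) ltac:(fold r; lra)).
      assert (He := ee_range (u s) ltac:(fold r; lra)).
      apply Rabs_le_between in He.
      fold r in HU, He.
      assert (E := level_identity (u s) Ol). fold q in E.
      rewrite <- rr_sq in E. fold r in E.
      (* the radial acceleration is at least that of the attraction alone *)
      assert (HA : q * q + r * r * (ee (u s) - UU (u s)) <= AA (u s) * (r * r)).
      { unfold AA, Gm. rewrite <- rr_sq. fold r.
        set (l := ll (u s)) in *.
        assert (Hsq := Rle_0_sqr (l + r * r)). unfold Rsqr in Hsq. lra. }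
      apply Rmult_le_pos; [apply Rdiv_le_0_compat; lra |].
      replace ((AA (u s) * r - q * (q / r)) / (r * r) + 11 / 10 / (r * r)) with
        ((AA (u s) * (r * r) - q * q + 11 / 10 * r) / (r * r * r)) by (field; lra).
      apply Rdiv_le_0_compat; [| repeat apply Rmult_lt_0_compat; lra].
      nra. }
  destruct (O z ltac:(lra)) as [Oz _].
  assert (HWz : W z < 0).
  { unfold W. rewrite Hz0. assert (0 < / rr (u z)) by (apply Rinv_0_lt_compat; lra).
    unfold Rdiv. lra. }
  assert (HWa : 0 < W a).
  { unfold W. replace (qq (u a) / rr (u a) * (qq (u a) / rr (u a)) / 2 - 11 / 10 * / rr (u a))
      with ((qq (u a) * qq (u a) - 11 / 5 * rr (u a)) / (2 * (rr (u a) * rr (u a)))) by (field; lra).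
    apply Rdiv_lt_0_compat; nra. }
  lra.
Qed.

End AlongFlow.


(** * Orbits launched at a pericentre opposite to the small primary *)

(** The square of the launching speed that puts [(-s, 0)] on the energy level. *)
Definition FF (s : R) : R :=
  s * s + 2 * ((1 - mu) / (s - mu) + mu / (s + 1 - mu)) - Cc.

Definition init (s : R) : state := mkState (- s) 0 0 (- sqrt (FF s)).

Lemma FF_lower s : 1.11 <= s -> 0.0055 <= FF s.
Proof.
  intros H. unfold FF.
  (* tangent lines at [s = 1.11] of two convex functions *)
  assert (H2 : 0.000452 - 0.00022 * (s - 1.11) <= mu / (s + 1 - mu)).
  { apply le_div_iff; [unfold mu; lra |]. set (x := s - 1.11).
    replace s with (x + 1.11) by (unfold x; lra). assert (0 <= x) by (unfold x; lra).
    unfold mu; nra. }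
  assert (H1 : 0.900815 - 0.8123 * (s - 1.11) <= (1 - mu) / (s - mu)).
  { apply le_div_iff; [unfold mu; lra |]. set (x := s - 1.11).
    replace s with (x + 1.11) by (unfold x; lra). assert (0 <= x) by (unfold x; lra).
    unfold mu; nra. }
  unfold Cc, mu in *. nra.
Qed.

Lemma init_rr s : 0 <= s -> rr (init s) = s.
Proof.
  intros H. unfold rr, rho, init; simpl.
  replace (- s * - s + 0 * 0) with (s * s) by ring. now apply sqrt_square.
Qed.

Lemma init_level s : 1.11 <= s -> level (init s).
Proof.
  intros H. unfold level, rho, UU.
  assert (D1 : d1 (init s) = s - mu).
  { unfold d1, r1, init; simpl.
    replace (_ + _) with ((s - mu) * (s - mu)) by ring.
    apply sqrt_square. unfold mu; lra. }
  assert (D2 : d2 (init s) = s + 1 - mu).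
  { unfold d2, r2, init; simpl.
    replace (_ + _) with ((s + 1 - mu) * (s + 1 - mu)) by ring.
    apply sqrt_square. unfold mu; lra. }
  rewrite D1, D2. unfold init; simpl.
  replace (- sqrt (FF s) * - sqrt (FF s)) with (sqrt (FF s) * sqrt (FF s)) by ring.
  rewrite sqrt_sqrt by (assert (HF := FF_lower s H); lra).
  unfold FF. ring.
Qed.

Lemma init_qq s : qq (init s) = 0.
Proof. unfold qq, init; simpl. ring. Qed.

Lemma init_Gm s : Gm (init s) = s * s + s * sqrt (FF s).
Proof. unfold Gm, ll, rho, init; simpl. ring. Qed.

(** The bound below on the denominator makes the rate continuous along every
    solution; it is inactive on the orbits in question. *)
Definition ang_rate (p : state) : R := ll p / Rmax (rho p) 1.

Definition ang (u : R -> state) (t : R) : R := PI + RInt (fun s => ang_rate (u s)) 0 t.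

Lemma Rmax_1_lip (a b : R) : Rabs (Rmax a 1 - Rmax b 1) <= Rabs (a - b).
Proof.
  unfold Rmax. destruct (Rle_dec a 1), (Rle_dec b 1);
    apply Rabs_le; pose proof (Rle_abs (a - b)); pose proof (Rabs_maj2 (a - b)); lra.
Qed.

Lemma cont_ang_rate (u : R -> state) : flow u -> forall t, continuous (fun s => ang_rate (u s)) t.
Proof.
  intros Hu t. apply continuity_pt_filterlim.
  unfold ang_rate. apply continuity_pt_div.
  - now apply cont_ll.
  - intros e He. destruct (cont_rho u Hu t e He) as [d [Hd H]].
    exists d. split; [exact Hd |]. intros x Hx. specialize (H x Hx). simpl in *.
    unfold R_dist in *. eapply Rle_lt_trans; [| exact H].
    apply Rmax_1_lip.
  - pose proof (Rmax_r (rho (u t)) 1) as Hm. lra.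
Qed.

Lemma der_ang (u : R -> state) : flow u -> forall t, is_derive (ang u) t (ang_rate (u t)).
Proof.
  intros Hu t. apply (integral_derive (fun s => ang_rate (u s))). now apply cont_ang_rate.
Qed.

Lemma ang_0 u : ang u 0 = PI.
Proof. unfold ang. rewrite RInt_point. unfold zero; simpl. ring. Qed.

Definition launch (s : R) (u : R -> state) : Prop := 1.11 <= s <= 2 /\ flow u /\ u 0 = init s.

(** In complex notation, [z * exp (- i * ang)] satisfies
    [w' = (qq / rho) * w], as does the radius; their quotient is constant. *)
Lemma polar s u T : launch s u -> 0 <= T -> (forall t, 0 <= t <= T -> 1 <= rho (u t)) ->
  px (u T) = rr (u T) * cos (ang u T) /\ py (u T) = rr (u T) * sin (ang u T).
Proof.
  intros [Hs [Hu H0]] HT Hrho.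
  set (th := ang u).
  set (a := fun t => px (u t) * cos (th t) + py (u t) * sin (th t)).
  set (b := fun t => py (u t) * cos (th t) - px (u t) * sin (th t)).
  assert (Hth : forall t, 0 <= t <= T -> is_derive th t (ll (u t) / rho (u t))).
  { intros t Ht. eapply der_eq; [apply (der_ang u Hu) |].
    unfold ang_rate. rewrite Rmax_left; [reflexivity | now apply Hrho]. }
  assert (Hcos : forall t, 0 <= t <= T ->
     is_derive (fun s => cos (th s)) t (- sin (th t) * (ll (u t) / rho (u t)))).
  { intros t Ht. apply der_comp; [apply is_derive_cos | now apply Hth]. }
  assert (Hsin : forall t, 0 <= t <= T ->
     is_derive (fun s => sin (th s)) t (cos (th t) * (ll (u t) / rho (u t)))).
  { intros t Ht. apply der_comp; [apply is_derive_sin | now apply Hth]. }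
  (* both components only scale with the distance *)
  assert (Ha : forall t, 0 <= t <= T -> is_derive a t (qq (u t) / rho (u t) * a t)).
  { intros t Ht. destruct (Hu t) as [A [B _]]. specialize (Hrho t Ht).
    eapply der_eq.
    - apply der_plus; (apply der_mult; [eassumption | auto]).
    - cbv beta. unfold a, qq, ll. field_simplify_eq; [| lra]. unfold rho. ring. }
  assert (Hb : forall t, 0 <= t <= T -> is_derive b t (qq (u t) / rho (u t) * b t)).
  { intros t Ht. destruct (Hu t) as [A [B _]]. specialize (Hrho t Ht).
    eapply der_eq.
    - apply der_minus; (apply der_mult; [eassumption | auto]).
    - cbv beta. unfold b, qq, ll. field_simplify_eq; [| lra]. unfold rho. ring. }
  assert (Hrr : forall t, 0 <= t <= T -> 0 < rr (u t)).
  { intros t Ht. apply sqrt_lt_R0. specialize (Hrho t Ht). lra. }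
  assert (Hconst : forall f, (forall t, 0 <= t <= T -> is_derive f t (qq (u t) / rho (u t) * f t)) ->
     f T / rr (u T) = f 0 / rr (u 0)).
  { intros f Hf.
    assert (E : Rabs (f T / rr (u T) - f 0 / rr (u 0)) <= 0 * (T - 0)).
    { apply (mvt_abs (fun t => f t / rr (u t)) (fun _ => 0)); [assumption | |].
      - intros t Ht. assert (Hp := Hrr t Ht). unfold Rdiv. eapply der_eq.
        + apply der_mult; [now apply Hf |].
          apply (is_derive_inv _ _ _ (der_rr u Hu t Hp)). simpl. lra.
        + cbv beta. rewrite <- (rr_sq (u t)). field. lra.
      - intros t _. rewrite Rabs_R0. lra. }
    rewrite Rmult_0_l in E. apply Rabs_le_between in E. lra. }
  assert (Ea := Hconst a Ha). assert (Eb := Hconst b Hb).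
  assert (Hp := Hrr T ltac:(lra)).
  assert (A0 : a 0 / rr (u 0) = 1).
  { unfold a, th. rewrite ang_0, H0, init_rr by lra. unfold init; simpl.
    rewrite cos_PI, sin_PI. field. lra. }
  assert (B0 : b 0 / rr (u 0) = 0).
  { unfold b, th. rewrite ang_0, H0, init_rr by lra. unfold init; simpl.
    rewrite cos_PI, sin_PI. field. lra. }
  assert (Fa : a T = rr (u T)).
  { rewrite A0 in Ea. apply (Rmult_eq_reg_r (/ rr (u T))).
    - rewrite Rinv_r by lra. exact Ea.
    - apply Rinv_neq_0_compat. lra. }
  assert (Fb : b T = 0).
  { rewrite B0 in Eb. apply (Rmult_eq_reg_r (/ rr (u T))).
    - rewrite Rmult_0_l. exact Eb.
    - apply Rinv_neq_0_compat. lra. }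
  assert (HSC := sin2_cos2 (th T)). unfold Rsqr in HSC.
  fold th. rewrite <- Fa. unfold a. unfold b in Fb.
  set (c := cos (th T)) in *. set (z := sin (th T)) in *.
  split.
  - transitivity (px (u T) * (z * z + c * c) + z * (py (u T) * c - px (u T) * z)).
    + rewrite HSC, Fb. ring.
    + ring.
  - transitivity (py (u T) * (z * z + c * c) - c * (py (u T) * c - px (u T) * z)).
    + rewrite HSC, Fb. ring.
    + ring.
Qed.

(** The rotating frame catches up with the launched orbit at an angular speed of
    at most one, so during two units of time the orbit stays on the far side of
    the small primary, where the torque is negligible. *)
Lemma early_phase s u T : launch s u -> 0 <= T <= 2 ->
  (forall t, 0 <= t <= T -> 0 <= qq (u t)) ->
  forall t, 0 <= t <= T ->
    s <= rr (u t) /\ level (u t) /\ Rabs (Gm (u t) - Gm (init s)) <= 0.001 * t /\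
    Rabs (ee (u t)) <= 0.00176 /\ qq (u t) <= rho (u t).
Proof.
  intros HL HT Hq. assert (HL' := HL). destruct HL' as [Hs [Hu H0]].
  assert (Hr0 : rr (u 0) = s) by (rewrite H0; apply init_rr; lra).
  assert (O := outgoing u Hu 0 T ltac:(lra) ltac:(lra)
    ltac:(rewrite H0; apply init_level; lra) Hq).
  rewrite Hr0 in O.
  assert (Hrho : forall t, 0 <= t <= T -> 1.23 <= rho (u t)).
  { intros t Ht. destruct (O t Ht). rewrite <- rr_sq. nra. }
  assert (Hspeed : forall t, 0 <= t <= T ->
     Rabs (ll (u t)) <= rho (u t) /\ qq (u t) <= rho (u t)).
  { intros t Ht. destruct (O t Ht) as [Or Ol]. specialize (Hrho t Ht).
    assert (E := level_identity _ Ol). assert (HU := UU_small (u t) ltac:(lra)).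
    assert (rho (u t) * (rho (u t) + 2 * UU (u t) - Cc) <= rho (u t) * rho (u t)).
    { apply Rmult_le_compat_l; unfold Cc, mu; lra. }
    pose proof (Rle_0_sqr (ll (u t))). pose proof (Rle_0_sqr (qq (u t))). unfold Rsqr in *.
    split; [apply abs_le_sq; lra |].
    apply Rle_trans with (Rabs (qq (u t))); [apply Rle_abs | apply abs_le_sq; lra]. }
  assert (Hang : forall t, 0 <= t <= T -> Rabs (ang u t - PI) <= t).
  { intros t Ht. rewrite <- (ang_0 u).
    replace t with (1 * (t - 0)) at 2 by ring.
    apply (mvt_abs (ang u) (fun t => ang_rate (u t))); [lra | |].
    - intros; now apply der_ang.
    - intros x Hx. destruct (Hspeed x ltac:(lra)) as [Hsp _]. specialize (Hrho x ltac:(lra)).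
      unfold ang_rate. rewrite Rmax_left by lra. unfold Rdiv.
      rewrite Rabs_mult, (Rabs_pos_eq (/ _)) by (left; apply Rinv_0_lt_compat; lra).
      apply div_le_iff; lra. }
  assert (Hx : forall t, 0 <= t <= T -> px (u t) <= rr (u t) / 2).
  { intros t Ht. destruct (polar s u t HL ltac:(lra)) as [P _].
    { intros x Hx. specialize (Hrho x ltac:(lra)). lra. }
    rewrite P. specialize (Hang t Ht).
    assert (Hc : cos (ang u t) <= 1 / 2).
    { replace (ang u t) with ((ang u t - PI) + PI) by ring. rewrite neg_cos.
      assert (HPI := PI2_3_2).
      assert (Hc : cos (2 * (PI / 3)) <= cos (Rabs (ang u t - PI))).
      { pose proof (Rabs_pos (ang u t - PI)). apply cos_decr_1; lra. }
      rewrite cos_2PI3 in Hc.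
      replace (cos (ang u t - PI)) with (cos (Rabs (ang u t - PI))).
      - lra.
      - unfold Rabs. destruct Rcase_abs; [apply cos_neg | reflexivity]. }
    destruct (O t Ht) as [Or _]. nra. }
  assert (Hd : forall t, 0 <= t <= T -> 1.1 <= d1 (u t) /\ 1 <= d2 (u t)).
  { intros t Ht. destruct (O t Ht) as [Or _]. split.
    - apply (clear_dist (u t)). lra.
    - apply d2_far; [lra | now apply Hx]. }
  intros t Ht. destruct (O t Ht) as [Or Ol]. split; [exact Or |]. split; [exact Ol |].
  split; [| split; [| now apply Hspeed]].
  - rewrite <- H0. replace (0.001 * t) with (0.001 * (t - 0)) by ring.
    apply (mvt_abs (fun t => Gm (u t)) (fun t => NN (u t))); [lra | |].
    + intros x Hx0. destruct (O x ltac:(lra)). apply der_Gm; [assumption | lra].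
    + intros x Hx0. destruct (Hd x ltac:(lra)) as [D1 D2].
      eapply Rle_trans; [apply (NN_bound _ 1); lra |].
      rewrite Rmult_1_l, Rinv_1. unfold mu. lra.
  - destruct (Hd t Ht) as [D1 D2].
    eapply Rle_trans; [apply (ee_bound _ 1.1 1); lra |].
    assert (/ (1.1 * 1.1) <= 0.83) by (apply (Rmult_le_reg_r (1.1 * 1.1)); [lra |]; rewrite Rinv_l; lra).
    rewrite Rmult_1_l, Rinv_1. unfold mu. lra.
Qed.

Lemma init_Gm_lower s : 1.11 <= s -> 1.3144 <= Gm (init s).
Proof.
  intros H. rewrite init_Gm.
  assert (0.07416 <= sqrt (FF s)).
  { rewrite <- (sqrt_square 0.07416) by lra. apply sqrt_le_1_alt.
    assert (HF := FF_lower s H). lra. }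
  nra.
Qed.

(** The constant is an upper bound for [Cc - 2 * Gm + |ee|], the worst case being
    [s = 1.11]. *)
Lemma early_pull s u T : launch s u -> 0 <= T <= 2 ->
  (forall t, 0 <= t <= T -> 0 <= qq (u t)) ->
  forall t, 0 <= t <= T -> (1 - mu) / (rr (u t) + mu) - 0.407 <= AA (u t).
Proof.
  intros HL HT Hq t Ht.
  destruct (early_phase s u T HL HT Hq t Ht) as [E1 [E2 [E3 [E4 _]]]].
  destruct HL as [Hs _]. assert (HG := init_Gm_lower s ltac:(lra)).
  assert (HU := UU_lower (u t) ltac:(lra)).
  apply Rabs_le_between in E3, E4. unfold AA. unfold Cc, mu in *. lra.
Qed.

Lemma rise_after (f : R -> R) (a l : R) : is_derive f a l -> f a = 0 -> 0 < l ->
  exists e, 0 < e /\ (forall t, a < t < a + e -> 0 < f t) /\ (forall t, a - e < t < a -> f t < 0).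
Proof.
  intros Hd H0 Hl. apply is_derive_Reals in Hd.
  destruct (Hd (l / 2)) as [d H]; [lra |].
  assert (Q : forall h, h <> 0 -> Rabs h < d -> 0 < f (a + h) / h).
  { intros h Hh Hhd. specialize (H h Hh Hhd). rewrite H0, Rminus_0_r in H.
    apply Rabs_lt_between in H. lra. }
  exists d. split; [apply cond_pos |]. split; intros t Ht.
  - assert (Hq := Q (t - a) ltac:(lra) ltac:(rewrite Rabs_pos_eq; lra)).
    replace (a + (t - a)) with t in Hq by ring.
    apply (Rmult_lt_compat_r (t - a)) in Hq; [| lra].
    unfold Rdiv in Hq. rewrite Rmult_assoc, Rinv_l in Hq by lra. lra.
  - assert (Hq := Q (t - a) ltac:(lra) ltac:(rewrite Rabs_left; lra)).
    replace (a + (t - a)) with t in Hq by ring.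
    apply (Rmult_lt_compat_r (a - t)) in Hq; [| lra].
    unfold Rdiv in Hq. rewrite Rmult_assoc in Hq.
    replace (/ (t - a) * (a - t)) with (-1) in Hq by (field; lra). lra.
Qed.

(** The estimates of the early phase give [0 < AA] only while [qq] is nonnegative.
    That is enough: [qq] increases up to its first zero, which contradicts the
    zero. *)
Lemma early_rise s u T : launch s u -> 0 < T <= 2 ->
  (forall z, 0 <= z <= T -> (forall t, 0 <= t <= z -> 0 <= qq (u t)) ->
     forall t, 0 <= t <= z -> 0 < AA (u t)) ->
  forall t, 0 < t <= T -> 0 < qq (u t).
Proof.
  intros HL HT H t Ht. assert (HL' := HL). destruct HL' as [Hs [Hu H0]].
  assert (Q0 : qq (u 0) = 0) by (rewrite H0; apply init_qq).
  assert (HA0 : 0 < AA (u 0)).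
  { apply (H 0); [lra | | lra]. intros x Hx. replace x with 0 by lra. lra. }
  assert (D0 : is_derive (fun s => qq (u s)) 0 (AA (u 0))).
  { apply (der_qq u Hu 0); rewrite H0; [rewrite init_rr; lra | apply init_level; lra]. }
  destruct (rise_after _ _ _ D0 Q0 HA0) as [e [He [Hpos _]]].
  destruct (Rlt_le_dec 0 (qq (u t))) as [|Hn]; [assumption | exfalso].
  set (a := Rmin t (e / 2)).
  assert (0 < a) by (apply Rmin_glb_lt; lra).
  assert (a <= e / 2) by apply Rmin_r. assert (a <= t) by apply Rmin_l.
  destruct (first_zero (fun s => qq (u s)) a t) as [z [Hz [Hz0 Hzp]]]; auto.
  { intros; now apply cont_qq. }
  { apply Hpos. lra. }
  assert (Hge : forall x, 0 <= x <= z -> 0 <= qq (u x)).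
  { intros x Hx. destruct (Req_dec x 0) as [-> |]; [lra |].
    destruct (Req_dec x z) as [-> |]; [lra |].
    left. destruct (Rlt_le_dec x a); [apply Hpos; lra | apply Hzp; lra]. }
  assert (qq (u 0) < qq (u z)); [| lra].
  apply (mvt_gt (fun s => qq (u s)) (fun s => AA (u s))); [lra | |].
  - intros x Hx. destruct (early_phase s u z HL ltac:(lra) Hge x Hx) as [E1 [E2 _]].
    apply der_qq; [assumption | lra | assumption].
  - apply (H z); [lra | exact Hge].
Qed.

(** The time [0.2] does not depend on [s], which later gives uniformity near the
    launching time. For small [s] the orbit is still within radius [1.95], where
    the potential outweighs the energy; for large [s] the energy is positive. *)
Lemma starts_outgoing s u : launch s u -> forall t, 0 < t <= 0.2 -> 0 < qq (u t).
Proof.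
  intros HL. apply (early_rise s u 0.2 HL); [lra |].
  intros z Hz Hge t Ht. assert (HL' := HL). destruct HL' as [Hs [Hu H0]].
  destruct (Rlt_le_dec s 1.5) as [Hlt | Hgt].
  - assert (Hr : rr (u t) <= 1.95).
    { assert (M : rho (u t) * (1 - 2 * t) - rho (u 0) * (1 - 2 * 0) <= 0 * (t - 0)).
      { apply (mvt_le (fun x => rho (u x) * (1 - 2 * x))
                 (fun x => 2 * qq (u x) * (1 - 2 * x) - rho (u x) * 2)); [lra | |].
        - intros x Hx. eapply der_eq.
          + apply der_mult; [now apply der_rho |].
            apply der_minus; [apply der_const |]. apply der_mult; [apply der_const | apply der_id].
          + cbv beta. ring.
        - intros x Hx. destruct (early_phase s u z HL ltac:(lra) Hge x ltac:(lra))
            as [_ [_ [_ [_ E]]]].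
          assert (Hqx := Hge x ltac:(lra)). nra. }
      assert (R0 : rho (u 0) = s * s) by (rewrite H0; unfold rho, init; simpl; ring).
      rewrite R0 in M. apply Rsqr_incr_0_var; [| lra]. unfold Rsqr. rewrite rr_sq.
      assert (0 <= rho (u t)) by apply rho_pos. nra. }
    assert (HP := early_pull s u z HL ltac:(lra) Hge t Ht).
    assert (0.51 <= (1 - mu) / (rr (u t) + mu)).
    { assert (0 <= rr (u t)) by apply rr_pos. apply le_div_iff; unfold mu; lra. }
    lra.
  - destruct (early_phase s u z HL ltac:(lra) Hge t Ht) as [E1 [E2 [E3 [E4 _]]]].
    assert (HU := UU_lower (u t) ltac:(lra)).
    assert (0 <= (1 - mu) / (rr (u t) + mu)) by (apply Rdiv_le_0_compat; unfold mu; lra).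
    assert (HG : 2.25 <= Gm (init s)).
    { rewrite init_Gm. pose proof (sqrt_pos (FF s)). nra. }
    apply Rabs_le_between in E3, E4. unfold AA, Cc, mu. lra.
Qed.

Definition first_return (u : R -> state) (tau : R) : Prop :=
  0 < tau /\ qq (u tau) = 0 /\ forall t, 0 < t < tau -> 0 < qq (u t).

Lemma outgoing_or_returns s u t : launch s u -> 0 < t -> qq (u t) <= 0 ->
  exists tau, tau <= t /\ first_return u tau.
Proof.
  intros HL Ht Hn. assert (HE := starts_outgoing s u HL). destruct HL as [Hs [Hu H0]].
  assert (0.2 < t).
  { destruct (Rlt_le_dec 0.2 t); [assumption |]. specialize (HE t). lra. }
  destruct (first_zero (fun s => qq (u s)) 0.2 t) as [z [Hz [Hz0 Hzp]]]; try lra.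
  { intros; now apply cont_qq. }
  { apply HE. lra. }
  exists z. split; [lra |]. split; [lra |]. split; [exact Hz0 |].
  intros x Hx. destruct (Rle_lt_dec x 0.2); [apply HE; lra | apply Hzp; lra].
Qed.

(** As long as the orbit is within radius [1.5], it is pushed outwards; the
    push brings it past that radius in two units of time. *)
Lemma clears_early s u : launch s u -> (forall t, 0 <= t <= 2 -> 0 <= qq (u t)) -> 1.5 <= rr (u 2).
Proof.
  intros HL Hq. destruct (Rle_lt_dec 1.5 (rr (u 2))) as [|Hlt]; [assumption | exfalso].
  assert (HL' := HL). destruct HL' as [Hs [Hu H0]].
  assert (HA : forall t, 0 <= t <= 2 -> 0.2584 <= AA (u t)).
  { intros t Ht. assert (HP := early_pull s u 2 HL ltac:(lra) Hq t Ht).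
    assert (rr (u t) <= rr (u 2)) by (apply rr_mono; [assumption | lra | intros; apply Hq; lra]).
    assert (0.6655 <= (1 - mu) / (rr (u t) + mu)).
    { assert (0 <= rr (u t)) by apply rr_pos. apply le_div_iff; unfold mu; lra. }
    lra. }
  assert (E := early_phase s u 2 HL ltac:(lra) Hq).
  assert (Hqt : forall t, 0 <= t <= 2 -> 0.2584 * t <= qq (u t)).
  { intros t Ht. assert (M : 0.2584 * (t - 0) <= qq (u t) - qq (u 0)).
    { apply (mvt_ge (fun x => qq (u x)) (fun x => AA (u x))); [lra | |].
      - intros x Hx. destruct (E x ltac:(lra)) as [E1 [E2 _]].
        apply der_qq; [assumption | lra | assumption].
      - intros x Hx. apply HA. lra. }
    rewrite H0, init_qq in M. lra. }
  assert (M : 0 * (2 - 0) <= (rho (u 2) - 0.2584 * (2 * 2)) - (rho (u 0) - 0.2584 * (0 * 0))).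
  { apply (mvt_ge (fun x => rho (u x) - 0.2584 * (x * x)) (fun x => 2 * qq (u x) - 0.2584 * (2 * x)));
      [lra | |].
    - intros x Hx. eapply der_eq.
      + apply der_minus; [now apply der_rho |].
        apply der_mult; [apply der_const |]. apply der_mult; apply der_id.
      + cbv beta. ring.
    - intros x Hx. specialize (Hqt x Hx). lra. }
  assert (R0 : rho (u 0) = s * s) by (rewrite H0; unfold rho, init; simpl; ring).
  rewrite R0, <- rr_sq in M. assert (0 <= rr (u 2)) by apply rr_pos. nra.
Qed.

(** The first return is an apocentre, and the radial velocity changes sign
    there at a nonzero rate. *)
Lemma return_transversal s u tau : launch s u -> first_return u tau ->
  1.5 <= rr (u tau) /\ level (u tau) /\ AA (u tau) < 0.
Proof.
  intros HL [Ht0 [Hq0 Hqp]]. assert (HL' := HL). destruct HL' as [Hs [Hu H0]].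
  assert (Hge : forall x, 0 <= x <= tau -> 0 <= qq (u x)).
  { intros x Hx. destruct (Req_dec x 0) as [-> |]; [rewrite H0, init_qq; lra |].
    destruct (Req_dec x tau) as [-> |]; [lra |]. left. apply Hqp. lra. }
  assert (O := outgoing u Hu 0 tau ltac:(lra) ltac:(rewrite H0, init_rr; lra)
    ltac:(rewrite H0; apply init_level; lra) Hge tau ltac:(lra)).
  destruct O as [_ Lv].
  assert (Hr : 1.5 <= rr (u tau)).
  { destruct (Rle_lt_dec tau 2) as [H2 | H2].
    - destruct (Rle_lt_dec 1.5 (rr (u tau))) as [|Hlt]; [assumption | exfalso].
      assert (E := early_phase s u tau HL ltac:(lra) Hge).
      assert (qq (u 0) < qq (u tau)); [| rewrite H0, init_qq in H; lra].
      apply (mvt_gt (fun x => qq (u x)) (fun x => AA (u x))); [lra | |].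
      + intros x Hx. destruct (E x ltac:(lra)) as [E1 [E2 _]].
        apply der_qq; [assumption | lra | assumption].
      + intros x Hx. assert (HP := early_pull s u tau HL ltac:(lra) Hge x Hx).
        assert (rr (u x) <= rr (u tau)) by (apply rr_mono; [assumption | lra | intros; apply Hge; lra]).
        assert (0.6655 <= (1 - mu) / (rr (u x) + mu)).
        { assert (0 <= rr (u x)) by apply rr_pos. apply le_div_iff; unfold mu; lra. }
        lra.
    - apply Rle_trans with (rr (u 2)).
      + apply (clears_early s u HL). intros; apply Hge; lra.
      + apply rr_mono; [assumption | lra |]. intros; apply Hge; lra. }
  split; [exact Hr |]. split; [exact Lv |].
  destruct (turning_point (u tau) Lv ltac:(lra) ltac:(rewrite Hq0; lra)) as [T1 T2].
  assert (Hi : 0 < / (1000 * rr (u tau))) by (apply Rinv_0_lt_compat; lra).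
  destruct (Rlt_le_dec (ll (u tau)) 0) as [Hl | Hl]; [specialize (T1 Hl); lra | exfalso].
  specialize (T2 Hl).
  assert (D : is_derive (fun s => qq (u s)) tau (AA (u tau))) by (apply der_qq; [assumption | lra | assumption]).
  destruct (rise_after _ _ _ D Hq0 ltac:(lra)) as [e [He [_ Hneg]]].
  set (x := Rmax (tau / 2) (tau - e / 2)).
  assert (tau / 2 <= x) by apply Rmax_l. assert (tau - e / 2 <= x) by apply Rmax_r.
  assert (x < tau) by (apply Rmax_lub_lt; lra).
  specialize (Hneg x ltac:(lra)). specialize (Hqp x ltac:(lra)). lra.
Qed.


(** * One launched orbit escapes and one returns *)

Lemma launch_outgoing s u : launch s u -> (forall t, 0 < t -> 0 < qq (u t)) ->
  forall t, 0 <= t -> 0 <= qq (u t) /\ s <= rr (u t) /\ level (u t).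
Proof.
  intros HL Hp t Ht. assert (HL' := HL). destruct HL' as [Hs [Hu H0]].
  assert (Hge : forall x, 0 <= x -> 0 <= qq (u x)).
  { intros x Hx. destruct (Req_dec x 0) as [-> |]; [rewrite H0, init_qq; lra |].
    left. apply Hp. lra. }
  split; [now apply Hge |].
  assert (O := outgoing u Hu 0 t Ht ltac:(rewrite H0, init_rr; lra)
    ltac:(rewrite H0; apply init_level; lra) ltac:(intros; apply Hge; lra) t ltac:(lra)).
  rewrite H0, init_rr in O by lra. exact O.
Qed.

Lemma launch_far s u : launch s u -> (forall t, 0 < t -> 0 < qq (u t)) ->
  forall t, 2 <= t -> 1.5 <= rr (u t).
Proof.
  intros HL Hp t Ht. assert (LO := launch_outgoing s u HL Hp).
  apply Rle_trans with (rr (u 2)).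
  - apply (clears_early s u HL). intros; apply LO; lra.
  - apply (rr_mono u); [apply HL | lra |]. intros; apply LO; lra.
Qed.

(** For two units of time the derivative of [qq] is at least [10], which brings
    the orbit far above the escape velocity. *)
Lemma escapes_from_2 u : launch 2 u -> forall t, 0 < t -> 0 < qq (u t).
Proof.
  intros HL. assert (HL' := HL). destruct HL' as [Hs [Hu H0]].
  assert (Hw : 1.4 <= sqrt (FF 2) <= 1.41).
  { assert (HF : 1.96 <= FF 2 <= 1.9881).
    { unfold FF, Cc.
      assert (0.499 <= (1 - mu) / (2 - mu) <= 0.5)
        by (split; [apply le_div_iff | apply div_le_iff]; unfold mu; lra).
      assert (0 <= mu / (2 + 1 - mu) <= 0.001)
        by (split; [apply le_div_iff | apply div_le_iff]; unfold mu; lra).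
      unfold mu in *; lra. }
    split.
    - rewrite <- (sqrt_square 1.4) by lra. apply sqrt_le_1_alt. lra.
    - rewrite <- (sqrt_square 1.41) by lra. apply sqrt_le_1_alt. lra. }
  assert (HG : 6.8 <= Gm (init 2) <= 6.82) by (rewrite init_Gm; lra).
  assert (HA : forall z, 0 <= z <= 2 -> (forall t, 0 <= t <= z -> 0 <= qq (u t)) ->
     forall t, 0 <= t <= z -> 10 <= AA (u t) <= 12).
  { intros z Hz Hge t Ht.
    destruct (early_phase 2 u z HL ltac:(lra) Hge t Ht) as [E1 [E2 [E3 [E4 _]]]].
    assert (HU := UU_lower (u t) ltac:(lra)). assert (HU' := UU_small (u t) ltac:(lra)).
    assert (0 <= (1 - mu) / (rr (u t) + mu)) by (apply Rdiv_le_0_compat; unfold mu; lra).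
    apply Rabs_le_between in E3, E4. unfold AA, Cc, mu. lra. }
  assert (P2 : forall t, 0 < t <= 2 -> 0 < qq (u t)).
  { apply (early_rise 2 u 2 HL); [lra |]. intros z Hz Hge t Ht.
    specialize (HA z Hz Hge t Ht). lra. }
  assert (G2 : forall t, 0 <= t <= 2 -> 0 <= qq (u t)).
  { intros t Ht. destruct (Req_dec t 0) as [-> |]; [rewrite H0, init_qq; lra |].
    left. apply P2. lra. }
  assert (E := early_phase 2 u 2 HL ltac:(lra) G2).
  assert (D : forall x, 0 <= x <= 2 -> is_derive (fun s => qq (u s)) x (AA (u x))).
  { intros x Hx. destruct (E x Hx) as [E1 [E2 _]]. apply der_qq; [assumption | lra | assumption]. }
  assert (Q0 : qq (u 0) = 0) by (rewrite H0; apply init_qq).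
  assert (Q1 : 10 * (2 - 0) <= qq (u 2) - qq (u 0)).
  { apply (mvt_ge (fun x => qq (u x)) (fun x => AA (u x))); [lra | assumption |].
    intros x Hx. apply (HA 2); [lra | exact G2 | exact Hx]. }
  assert (Q2 : forall x, 0 <= x <= 2 -> qq (u x) <= 24).
  { intros x Hx. assert (M : qq (u x) - qq (u 0) <= 12 * (x - 0)).
    { apply (mvt_le (fun x => qq (u x)) (fun x => AA (u x))); [lra | intros; apply D; lra |].
      intros y Hy. apply (HA 2); [lra | exact G2 | lra]. }
    lra. }
  assert (R2 : rho (u 2) - rho (u 0) <= 48 * (2 - 0)).
  { apply (mvt_le (fun x => rho (u x)) (fun x => 2 * qq (u x))); [lra | |].
    - intros; now apply der_rho.
    - intros x Hx. specialize (Q2 x Hx). lra. }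
  assert (R0 : rho (u 0) = 4) by (rewrite H0; unfold rho, init; simpl; ring).
  destruct (E 2 ltac:(lra)) as [E1 [E2 _]].
  assert (Hr : rr (u 2) <= 10).
  { apply Rsqr_incr_0_var; [| lra]. unfold Rsqr. rewrite rr_sq. lra. }
  intros t Ht. destruct (Rle_lt_dec t 2); [apply P2; lra |].
  apply (escape u Hu 2); [lra | assumption | lra | nra | lra].
Qed.

Lemma cont_acc (u : R -> state) : flow u -> forall t,
  continuity_pt (fun s => accx (u s)) t /\ continuity_pt (fun s => accy (u s)) t.
Proof.
  intros Hu t.
  set (w := fun j s => match j with CX => px (u s) | CY => py (u s)
                              | CVX => vx (u s) | CVY => vy (u s) end).
  assert (Hw : forall j, continuous (w j) t).
  { destruct (Hu t) as [A [B [C D]]].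
    intros j. destruct j; apply continuity_pt_filterlim; eapply deriv_cont; eassumption. }
  assert (E : forall s, to_state (fun j => w j s) = u s) by (intros s; unfold to_state, w; now destruct (u s)).
  split; apply continuity_pt_filterlim.
  - apply (continuous_ext (fun s => field (fun j => w j s) CVX)); [intros s; simpl; now rewrite E |].
    now apply field_cont.
  - apply (continuous_ext (fun s => field (fun j => w j s) CVY)); [intros s; simpl; now rewrite E |].
    now apply field_cont.
Qed.

(** An orbit that never turns back is unbounded, since it has no circular orbit
    to spiral towards. *)
Lemma unbounded s u : launch s u -> (forall t, 0 < t -> 0 < qq (u t)) ->
  forall B, exists t, 2 <= t /\ B <= rr (u t).
Proof.
  intros HL Hp B. apply NNPP. intros Hno.
  assert (HB : forall t, 2 <= t -> rr (u t) < B).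
  { intros t Ht. apply Rnot_le_lt. intros Hle. apply Hno. now exists t. }
  assert (LO := launch_outgoing s u HL Hp). assert (LF := launch_far s u HL Hp).
  assert (HL' := HL). destruct HL' as [Hs [Hu H0]].
  assert (HB0 : 1.5 < B) by (specialize (HB 2 ltac:(lra)); specialize (LF 2 ltac:(lra)); lra).
  set (m := Rmin (qq (u 2)) 0.03).
  assert (Hm0 : 0 < m) by (apply Rmin_glb_lt; [apply Hp |]; lra).
  assert (Hm : forall t, 2 <= t -> m <= qq (u t)).
  { apply (positive_no_stagnation (fun s => qq (u s)) (fun s =>
      vx (u s) * vx (u s) + vy (u s) * vy (u s) + (px (u s) * accx (u s) + py (u s) * accy (u s)))
      2 0.03 (/ (1000 * B))); try lra.
    - apply Rinv_0_lt_compat. lra.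
    - intros t _. now apply der_qq_raw.
    - intros t _. destruct (Hu t) as [A [B' [C D]]]. destruct (cont_acc u Hu t) as [X Y].
      apply deriv_cont in A. apply deriv_cont in B'. apply deriv_cont in C. apply deriv_cont in D.
      apply continuity_pt_plus; apply continuity_pt_plus; apply continuity_pt_mult; assumption.
    - intros t Ht. apply Hp. lra.
    - intros t Ht Hqt. specialize (LF t Ht). destruct (LO t ltac:(lra)) as [L1 [L2 L3]].
      assert (E := is_derive_unique _ _ _ (der_qq_raw u Hu t)).
      assert (E' := is_derive_unique _ _ _ (der_qq u Hu t ltac:(lra) L3)).
      rewrite <- E, E'.
      destruct (turning_point (u t) L3 ltac:(lra) ltac:(nra)) as [T1 T2].
      assert (Hi : 0 < / (1000 * B)) by (apply Rinv_0_lt_compat; lra).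
      assert (Hc : / (1000 * B) <= / (1000 * rr (u t))).
      { specialize (HB t Ht). apply Rinv_le_contravar; lra. }
      destruct (Rlt_le_dec (ll (u t)) 0) as [Hl | Hl].
      + specialize (T1 Hl). rewrite Rabs_left; lra.
      + specialize (T2 Hl). rewrite Rabs_pos_eq; lra. }
  set (T := 2 + B * B / (2 * m)).
  assert (HT : 0 < B * B / (2 * m)) by (apply Rdiv_lt_0_compat; nra).
  assert (M : 2 * m * (T - 2) <= rho (u T) - rho (u 2)).
  { apply (mvt_ge (fun x => rho (u x)) (fun x => 2 * qq (u x))); [unfold T; lra | |].
    - intros; now apply der_rho.
    - intros x Hx. specialize (Hm x ltac:(lra)). lra. }
  replace (2 * m * (T - 2)) with (B * B) in M by (unfold T; field; lra).
  specialize (HB T ltac:(unfold T; lra)). rewrite <- !rr_sq in M.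
  pose proof (rr_pos (u T)). specialize (LF 2 ltac:(lra)). nra.
Qed.

(** The drift [de] allowed for the angular momentum fixes a lower bound [qm] for
    [qq], hence an upper bound for the duration of the leg from radius [ra] to
    [rb], hence a bound for the drift; the last hypothesis closes the circle. *)
Lemma leg u a ra rb qm Gl Gh de : flow u -> (forall t, a <= t -> 0 < qq (u t)) ->
  level (u a) -> 1.35 <= ra -> ra <= rr (u a) -> ra <= rb -> 0 < qm ->
  Gl <= Gm (u a) <= Gh ->
  (forall p, level p -> ra <= rr p <= rb -> Gl - de <= Gm p <= Gh + de -> 0 <= qq p ->
     qm <= qq p) ->
  mu * / ((ra - 1) * (ra - 1)) * ((rb * rb - ra * ra) / (2 * qm)) <= de ->
  exists b, a <= b /\ rb <= rr (u b) /\ Gl - de <= Gm (u b) <= Gh + de /\ level (u b).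
Proof.
  intros Hu Hp Lv H1 Hra Hab Hqm HG Hq Hde.
  set (T := (rb * rb - ra * ra) / (2 * qm)) in *.
  set (d := mu * / ((ra - 1) * (ra - 1))) in *.
  assert (HT : 0 <= T) by (apply Rdiv_le_0_compat; nra).
  assert (O := outgoing u Hu a (a + T) ltac:(lra) ltac:(lra) Lv
    ltac:(intros; left; apply Hp; lra)).
  assert (Hd : 0 <= d).
  { apply Rmult_le_pos; [unfold mu; lra |]. left. apply Rinv_0_lt_compat. nra. }
  assert (HGt : forall t, a <= t <= a + T -> Gl - de <= Gm (u t) <= Gh + de).
  { intros t Ht. assert (M : Rabs (Gm (u t) - Gm (u a)) <= d * (t - a)).
    { apply (mvt_abs (fun x => Gm (u x)) (fun x => NN (u x))); [lra | |].
      - intros x Hx. destruct (O x ltac:(lra)). apply der_Gm; [assumption | lra].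
      - intros x Hx. destruct (O x ltac:(lra)) as [Or _].
        assert (R1 := d1_range (u x) ltac:(unfold mu; lra)).
        assert (R2 := d2_range (u x) ltac:(unfold mu; lra)).
        apply NN_bound; unfold mu in *; lra. }
    assert (d * (t - a) <= d * T) by (apply Rmult_le_compat_l; lra).
    apply Rabs_le_between in M. lra. }
  exists (a + T). destruct (O (a + T) ltac:(lra)) as [Or Ol].
  split; [lra |]. split; [| split; [apply HGt; lra | exact Ol]].
  apply Rnot_lt_le. intros Hlt.
  assert (M : 2 * qm * (a + T - a) <= rho (u (a + T)) - rho (u a)).
  { apply (mvt_ge (fun x => rho (u x)) (fun x => 2 * qq (u x))); [lra | |].
    - intros; now apply der_rho.
    - intros x Hx. destruct (O x Hx) as [Xr Xl].
      assert (rr (u x) <= rr (u (a + T))).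
      { apply rr_mono; [assumption | lra |]. intros; left; apply Hp; lra. }
      assert (qm <= qq (u x)); [| lra].
      apply Hq; [assumption | lra | now apply HGt | left; apply Hp; lra]. }
  replace (2 * qm * (a + T - a)) with (rb * rb - ra * ra) in M by (unfold T; field; lra).
  rewrite <- !rr_sq in M. pose proof (rr_pos (u (a + T))). nra.
Qed.

Lemma radial_speed p : level p ->
  qq p * qq p = 2 * (rr p * rr p) * UU p - (Cc - 2 * Gm p) * (rr p * rr p) - Gm p * Gm p.
Proof.
  intros Lv. assert (E := level_identity p Lv). rewrite rr_sq. unfold Gm. lra.
Qed.

Lemma speed_lower p qm gl gh : level p -> 1.35 <= rr p -> gl <= Gm p <= gh -> 0 < gl -> 0 <= qq p ->
  qm * qm <= 1.996 * rr p - (3.0291 - 2 * gl) * (rr p * rr p) - gh * gh -> 0 < qm -> qm <= qq p.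
Proof.
  intros Lv Hr HG Hgl Hq H Hqm. assert (E := radial_speed p Lv). assert (HU := UU_range p Hr).
  assert (rr p * 0.998 <= rr p * (rr p * UU p)) by (apply Rmult_le_compat_l; lra).
  assert (Gm p * Gm p <= gh * gh) by nra.
  assert ((Cc - 2 * Gm p) * (rr p * rr p) <= (3.0291 - 2 * gl) * (rr p * rr p)).
  { apply Rmult_le_compat_r; [nra |]. unfold Cc, mu. lra. }
  apply Rsqr_incr_0_var; [| assumption]. unfold Rsqr. lra.
Qed.

(** If the orbit did not return, it would travel outwards through the radii [1.5],
    [2] and [3.2]. On each leg the angular momentum, and with it the energy
    [Gm - Cc / 2], drifts by little, so the energy stays negative; beyond radius
    [3.2] this makes the derivative of [qq] negative for long enough to turn the
    orbit back. *)
Lemma returns_from_111 u : launch 1.11 u -> exists tau, first_return u tau.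
Proof.
  intros HL. apply NNPP. intros Hno.
  assert (Hp : forall t, 0 < t -> 0 < qq (u t)).
  { intros t Ht. apply Rnot_le_lt. intros Hn.
    destruct (outgoing_or_returns 1.11 u t HL Ht Hn) as [tau [_ F]]. apply Hno. now exists tau. }
  assert (LO := launch_outgoing 1.11 u HL Hp). assert (LF := launch_far 1.11 u HL Hp).
  assert (HL' := HL). destruct HL' as [Hs [Hu H0]].
  assert (Hw : sqrt (FF 1.11) <= 0.0755).
  { assert (HF : FF 1.11 <= 0.0057).
    { unfold FF, Cc.
      assert ((1 - mu) / (1.11 - mu) <= 0.90083) by (apply div_le_iff; unfold mu; lra).
      assert (mu / (1.11 + 1 - mu) <= 0.000453) by (apply div_le_iff; unfold mu; lra).
      unfold mu in *; lra. }
    rewrite <- (sqrt_square 0.0755) by lra. apply sqrt_le_1_alt. lra. }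
  assert (HG0 : 1.3144 <= Gm (init 1.11) <= 1.316).
  { split; [apply init_Gm_lower; lra | rewrite init_Gm; lra]. }
  destruct (early_phase 1.11 u 2 HL ltac:(lra) ltac:(intros; apply LO; lra) 2 ltac:(lra))
    as [_ [L2 [G2 _]]].
  apply Rabs_le_between in G2.
  destruct (leg u 2 1.5 2 0.54 1.312 1.3185 0.0065) as [b [Hb [Rb [Gb Lb]]]];
    try assumption; try lra.
  { intros; apply Hp; lra. }
  { apply LF; lra. }
  { intros p Lp Hrp HGp Hqp.
    apply (speed_lower p 0.54 1.3055 1.325); try assumption; try lra.
    assert (0 <= (rr p - 1.5) * (2 - rr p)) by (apply Rmult_le_pos; lra). lra. }
  { unfold mu. lra. }
  destruct (leg u b 2 3.2 0.4 1.3055 1.325 0.008) as [c [Hc [Rc [Gc Lc]]]];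
    try assumption; try lra.
  { intros; apply Hp; lra. }
  { intros p Lp Hrp HGp Hqp.
    apply (speed_lower p 0.4 1.2975 1.333); try assumption; try lra.
    assert (0 <= (rr p - 2) * (3.2 - rr p)) by (apply Rmult_le_pos; lra). lra. }
  { unfold mu. lra. }
  (* past radius 3.2 the pull is inwards at a definite rate *)
  assert (O := outgoing u Hu c (c + 40) ltac:(lra) ltac:(lra) Lc
    ltac:(intros; left; apply Hp; lra)).
  assert (HGt : forall t, c <= t <= c + 40 -> Gm (u t) <= 1.341).
  { intros t Ht. assert (M : Rabs (Gm (u t) - Gm (u c)) <= 0.0002 * (t - c)).
    { apply (mvt_abs (fun x => Gm (u x)) (fun x => NN (u x))); [lra | |].
      - intros x Hx. destruct (O x ltac:(lra)). apply der_Gm; [assumption | lra].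
      - intros x Hx. destruct (O x ltac:(lra)) as [Or _].
        assert (R1 := d1_range (u x) ltac:(unfold mu; lra)).
        assert (R2 := d2_range (u x) ltac:(unfold mu; lra)).
        eapply Rle_trans; [apply (NN_bound _ 2.2); unfold mu in *; lra |].
        unfold mu. lra. }
    apply Rabs_le_between in M. lra. }
  assert (HA : forall t, c <= t <= c + 40 -> AA (u t) <= - 0.0285).
  { intros t Ht. destruct (O t Ht) as [Or _]. specialize (HGt t Ht).
    assert (HU := UU_range (u t) ltac:(lra)). assert (He := ee_range (u t) ltac:(lra)).
    apply Rabs_le_between in He.
    assert (UU (u t) + ee (u t) <= 0.3175) by nra.
    unfold AA, Cc, mu. lra. }
  assert (Hqc : qq (u c) <= 1.06).
  { assert (E := radial_speed _ Lc). assert (HU := UU_range (u c) ltac:(lra)).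
    assert (rr (u c) * (rr (u c) * UU (u c)) <= rr (u c) * 1.004) by (apply Rmult_le_compat_l; lra).
    assert (1.2975 * 1.2975 <= Gm (u c) * Gm (u c)) by nra.
    assert ((3.029 - 2 * 1.333) * (rr (u c) * rr (u c)) <= (Cc - 2 * Gm (u c)) * (rr (u c) * rr (u c))).
    { apply Rmult_le_compat_r; [nra |]. unfold Cc, mu. lra. }
    assert (0 <= (363 * rr (u c) - 1004) * (363 * rr (u c) - 1004)) by apply Rle_0_sqr.
    apply Rsqr_incr_0_var; [| lra]. unfold Rsqr. lra. }
  assert (M : qq (u (c + 40)) - qq (u c) <= - 0.0285 * (c + 40 - c)).
  { apply (mvt_le (fun x => qq (u x)) (fun x => AA (u x))); [lra | | exact HA].
    intros x Hx. destruct (O x Hx). apply der_qq; [assumption | lra | assumption]. }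
  specialize (Hp (c + 40) ltac:(lra)). lra.
Qed.


(** * Dependence on the launching point *)

Definition orb (s : R) : R -> state :=
  proj1_sig (constructive_indefinite_description _ (flow_exists (init s))).

Lemma orb_launch s : 1.11 <= s <= 2 -> launch s (orb s).
Proof.
  intros Hs. split; [exact Hs |]. unfold orb.
  exact (proj2_sig (constructive_indefinite_description _ (flow_exists (init s)))).
Qed.

Lemma cont_sqrt_FF s : 1.11 <= s -> continuity_pt (fun s => sqrt (FF s)) s.
Proof.
  intros Hs. assert (HF := FF_lower s Hs).
  assert (D : ex_derive FF s).
  { unfold FF. auto_derive. unfold mu. split; [lra | split; [lra | exact I]]. }
  destruct D as [l D]. eapply deriv_cont. apply is_derive_sqrt; [exact D | lra].
Qed.

Lemma orb_close s0 T e : 1.11 <= s0 <= 2 -> 0 <= T -> 0 < e ->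
  exists d, 0 < d /\ forall s, 1.11 <= s <= 2 -> Rabs (s - s0) < d ->
    forall t, 0 <= t <= T -> within e (orb s t) (orb s0 t).
Proof.
  intros Hs0 HT He.
  set (g := sqrt (e * e / exp (120000 * T) / 2)).
  assert (HX : 0 < exp (120000 * T)) by apply exp_pos.
  assert (Hg0 : 0 < e * e / exp (120000 * T) / 2).
  { apply Rdiv_lt_0_compat; [apply Rdiv_lt_0_compat; nra | lra]. }
  assert (Hg : 0 < g) by (now apply sqrt_lt_R0).
  assert (Hgg : g * g = e * e / exp (120000 * T) / 2) by (apply sqrt_sqrt; lra).
  destruct (cont_sqrt_FF s0 ltac:(lra) g Hg) as [d [Hd H]].
  exists (Rmin d g). split; [apply Rmin_glb_lt; assumption |].
  intros s Hs Hds t Ht.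
  assert (Hd1 : Rabs (s - s0) < d) by (eapply Rlt_le_trans; [exact Hds | apply Rmin_l]).
  assert (Hd2 : Rabs (s - s0) < g) by (eapply Rlt_le_trans; [exact Hds | apply Rmin_r]).
  assert (Hsq : Rabs (sqrt (FF s) - sqrt (FF s0)) < g).
  { destruct (Req_dec s s0) as [-> | Hne].
    - replace (_ - _) with 0 by ring. now rewrite Rabs_R0.
    - apply (H s). split; [split; [exact I | auto] | exact Hd1]. }
  destruct (orb_launch s Hs) as [_ [Fs Is]]. destruct (orb_launch s0 Hs0) as [_ [F0 I0]].
  assert (D := flow_dist _ _ Fs F0 t). rewrite Is, I0 in D.
  rewrite (Rabs_pos_eq t) in D by lra.
  assert (D0 : dist2 (init s) (init s0) <= e * e / exp (120000 * T)).
  { unfold dist2, init; simpl.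
    apply Rabs_lt_between in Hd2, Hsq.
    set (a := sqrt (FF s)) in *. set (b := sqrt (FF s0)) in *. nra. }
  assert (D1 : dist2 (orb s t) (orb s0 t) <= e * e).
  { eapply Rle_trans; [exact D |].
    apply Rle_trans with (e * e / exp (120000 * T) * exp (120000 * T)).
    - apply Rmult_le_compat; [apply dist2_pos | left; apply exp_pos | exact D0 |].
      apply exp_mono. lra.
    - right. field. lra. }
  assert (W := dist2_within (orb s t) (orb s0 t)).
  assert (Hse : sqrt (dist2 (orb s t) (orb s0 t)) <= e).
  { rewrite <- (sqrt_square e) by lra. now apply sqrt_le_1_alt. }
  destruct W as [W1 [W2 [W3 W4]]]. unfold within. lra.
Qed.

Definition inbox (B : R) (p : state) : Prop :=
  Rabs (px p) <= B /\ Rabs (py p) <= B /\ Rabs (vx p) <= B /\ Rabs (vy p) <= B.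

(** Local Lipschitz continuity at the points of a box, with a bound on the values
    there, which makes the class stable under products. *)
Definition loc_lip (g : state -> R) : Prop := forall B, exists K M, 0 <= K /\ 0 <= M /\
  forall p p' d, 0 <= d <= 1 -> inbox B p' -> within d p p' ->
    Rabs (g p - g p') <= K * d /\ Rabs (g p') <= M.

Lemma loc_lip_coord : loc_lip px /\ loc_lip py /\ loc_lip vx /\ loc_lip vy.
Proof.
  repeat split; intros B; exists 1, (Rabs B);
    (split; [lra | split; [apply Rabs_pos |]]);
    intros p p' d Hd [B1 [B2 [B3 B4]]] [W1 [W2 [W3 W4]]];
    pose proof (Rle_abs B); split; lra.
Qed.

Lemma loc_lip_const c : loc_lip (fun _ => c).
Proof.
  intros B. exists 0, (Rabs c). split; [lra | split; [apply Rabs_pos |]].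
  intros p p' d _ _ _. replace (c - c) with 0 by ring. rewrite Rabs_R0. lra.
Qed.

Lemma loc_lip_plus g h : loc_lip g -> loc_lip h -> loc_lip (fun p => g p + h p).
Proof.
  intros Hg Hh B. destruct (Hg B) as [K [M [HK [HM H]]]].
  destruct (Hh B) as [K' [M' [HK' [HM' H']]]].
  exists (K + K'), (M + M'). split; [lra | split; [lra |]].
  intros p p' d Hd Hb Hw. destruct (H p p' d Hd Hb Hw) as [A1 A2].
  destruct (H' p p' d Hd Hb Hw) as [B1 B2]. split.
  - replace (g p + h p - (g p' + h p')) with ((g p - g p') + (h p - h p')) by ring.
    eapply Rle_trans; [apply Rabs_triang |]. lra.
  - eapply Rle_trans; [apply Rabs_triang |]. lra.
Qed.

Lemma loc_lip_mult g h : loc_lip g -> loc_lip h -> loc_lip (fun p => g p * h p).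
Proof.
  intros Hg Hh B. destruct (Hg B) as [K [M [HK [HM H]]]].
  destruct (Hh B) as [K' [M' [HK' [HM' H']]]].
  exists (K * (M' + K') + M * K'), (M * M').
  split; [nra | split; [nra |]].
  intros p p' d Hd Hb Hw. destruct (H p p' d Hd Hb Hw) as [A1 A2].
  destruct (H' p p' d Hd Hb Hw) as [B1 B2]. split.
  - replace (g p * h p - g p' * h p') with
      ((g p - g p') * ((h p - h p') + h p') + g p' * (h p - h p')) by ring.
    eapply Rle_trans; [apply Rabs_triang |]. rewrite !Rabs_mult.
    assert (C : Rabs (h p - h p' + h p') <= M' + K').
    { eapply Rle_trans; [apply Rabs_triang |]. nra. }
    assert (C1 : Rabs (g p - g p') * Rabs (h p - h p' + h p') <= K * d * (M' + K'))
      by (apply Rmult_le_compat; auto using Rabs_pos).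
    assert (C2 : Rabs (g p') * Rabs (h p - h p') <= M * (K' * d))
      by (apply Rmult_le_compat; auto using Rabs_pos).
    lra.
  - rewrite Rabs_mult. apply Rmult_le_compat; auto using Rabs_pos.
Qed.

Lemma loc_lip_comp f g : (forall a b, Rabs (f a - f b) <= Rabs (a - b)) ->
  (forall a, Rabs (f a) <= 1) -> loc_lip g -> loc_lip (fun p => f (g p)).
Proof.
  intros Hf Hb Hg B. destruct (Hg B) as [K [M [HK [HM H]]]].
  exists K, 1. split; [lra | split; [lra |]].
  intros p p' d Hd Hbx Hw. destruct (H p p' d Hd Hbx Hw) as [A1 A2].
  split; [eapply Rle_trans; [apply Hf | exact A1] | apply Hb].
Qed.

Lemma loc_lip_qq : loc_lip qq.
Proof.
  destruct loc_lip_coord as [A [B [C D]]].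
  apply loc_lip_plus; apply loc_lip_mult; assumption.
Qed.

Lemma loc_lip_rho : loc_lip rho.
Proof.
  destruct loc_lip_coord as [A [B [C D]]].
  apply loc_lip_plus; apply loc_lip_mult; assumption.
Qed.

Lemma loc_lip_ll : loc_lip ll.
Proof.
  destruct loc_lip_coord as [A [B [C D]]]. unfold ll, Rminus.
  apply loc_lip_plus; [apply loc_lip_mult; assumption |].
  intros X. destruct (loc_lip_mult _ _ B C X) as [K [M [HK [HM H]]]].
  exists K, M. split; [assumption | split; [assumption |]].
  intros p p' d Hd Hb Hw. destruct (H p p' d Hd Hb Hw) as [A1 A2].
  split; [| now rewrite Rabs_Ropp].
  replace (- (py p * vx p) - - (py p' * vx p')) with
    (- (py p * vx p - py p' * vx p')) by ring. now rewrite Rabs_Ropp.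
Qed.

Lemma inv_le_1 a : 1 <= a -> 0 < / a <= 1.
Proof.
  intros H. split; [apply Rinv_0_lt_compat; lra |].
  rewrite <- Rinv_1. apply Rinv_le_contravar; lra.
Qed.

Lemma loc_lip_ang_rate : loc_lip ang_rate.
Proof.
  apply loc_lip_mult; [apply loc_lip_ll |].
  apply (loc_lip_comp (fun a => / Rmax a 1)); [| | apply loc_lip_rho].
  - intros a b. assert (L := Rmax_1_lip b a).
    assert (1 <= Rmax a 1) by apply Rmax_r. assert (1 <= Rmax b 1) by apply Rmax_r.
    replace (/ Rmax a 1 - / Rmax b 1) with ((Rmax b 1 - Rmax a 1) * (/ Rmax a 1 * / Rmax b 1))
      by (field; lra).
    assert (0 < / Rmax a 1 <= 1) by now apply inv_le_1.
    assert (0 < / Rmax b 1 <= 1) by now apply inv_le_1.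
    set (i := / Rmax a 1) in *. set (j := / Rmax b 1) in *.
    assert (Hij : 0 <= i * j <= 1) by nra.
    rewrite Rabs_mult, (Rabs_pos_eq (i * j)) by lra.
    rewrite (Rabs_minus_sym a b). pose proof (Rabs_pos (Rmax b 1 - Rmax a 1)). nra.
  - intros a. assert (1 <= Rmax a 1) by apply Rmax_r.
    destruct (inv_le_1 _ H). rewrite Rabs_pos_eq; lra.
Qed.

Lemma observable_close g s0 T e : loc_lip g -> 1.11 <= s0 <= 2 -> 0 <= T -> 0 < e ->
  exists d, 0 < d /\ forall s, 1.11 <= s <= 2 -> Rabs (s - s0) < d ->
    forall t, 0 <= t <= T -> Rabs (g (orb s t) - g (orb s0 t)) < e.
Proof.
  intros Hg Hs0 HT He. destruct (orb_launch s0 Hs0) as [_ [F0 _]].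
  assert (Bd : forall f : R -> R, (forall t, continuity_pt f t) ->
     exists M, forall t, 0 <= t <= T -> Rabs (f t) <= M).
  { intros f Hf. destruct (bounded_continuity (V := R_NormedModule) f 0 T) as [M HM].
    - intros t _. apply continuity_pt_filterlim, Hf.
    - exists M. intros t Ht. left. exact (HM t Ht). }
  destruct (Bd (fun t => px (orb s0 t))) as [M1 H1].
  { intros t. destruct (F0 t) as [A [B [C D]]]. eapply deriv_cont; eassumption. }
  destruct (Bd (fun t => py (orb s0 t))) as [M2 H2].
  { intros t. destruct (F0 t) as [A [B [C D]]]. eapply deriv_cont; eassumption. }
  destruct (Bd (fun t => vx (orb s0 t))) as [M3 H3].
  { intros t. destruct (F0 t) as [A [B [C D]]]. eapply deriv_cont; eassumption. }
  destruct (Bd (fun t => vy (orb s0 t))) as [M4 H4].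
  { intros t. destruct (F0 t) as [A [B [C D]]]. eapply deriv_cont; eassumption. }
  set (B := Rmax (Rmax M1 M2) (Rmax M3 M4)).
  assert (HB : forall t, 0 <= t <= T -> inbox B (orb s0 t)).
  { intros t Ht. specialize (H1 t Ht). specialize (H2 t Ht). specialize (H3 t Ht).
    specialize (H4 t Ht). unfold inbox, B.
    pose proof (Rmax_l M1 M2). pose proof (Rmax_r M1 M2).
    pose proof (Rmax_l M3 M4). pose proof (Rmax_r M3 M4).
    pose proof (Rmax_l (Rmax M1 M2) (Rmax M3 M4)). pose proof (Rmax_r (Rmax M1 M2) (Rmax M3 M4)).
    lra. }
  destruct (Hg B) as [K [M [HK [HM H]]]].
  set (x := Rmin 1 (e / (K + 1))).
  assert (Hx0 : 0 < x) by (apply Rmin_glb_lt; [lra | apply Rdiv_lt_0_compat; lra]).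
  assert (Hx1 : x <= 1) by apply Rmin_l.
  assert (Hx2 : x <= e / (K + 1)) by apply Rmin_r.
  destruct (orb_close s0 T x Hs0 HT Hx0) as [d [Hd Hc]].
  exists d. split; [exact Hd |]. intros s Hs Hds t Ht.
  destruct (H (orb s t) (orb s0 t) x ltac:(lra) (HB t Ht) (Hc s Hs Hds t Ht)) as [A _].
  eapply Rle_lt_trans; [exact A |].
  apply Rmult_le_compat_l with (r := K + 1) in Hx2; [| lra].
  replace ((K + 1) * (e / (K + 1))) with e in Hx2 by (field; lra). lra.
Qed.

Lemma angle_close s0 T e : 1.11 <= s0 <= 2 -> 0 <= T -> 0 < e ->
  exists d, 0 < d /\ forall s, 1.11 <= s <= 2 -> Rabs (s - s0) < d ->
    forall t, 0 <= t <= T -> Rabs (ang (orb s) t - ang (orb s0) t) < e.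
Proof.
  intros Hs0 HT He.
  destruct (observable_close ang_rate s0 T (e / (T + 1)) loc_lip_ang_rate Hs0 HT) as [d [Hd H]].
  { apply Rdiv_lt_0_compat; lra. }
  exists d. split; [exact Hd |]. intros s Hs Hds t Ht.
  destruct (orb_launch s Hs) as [_ [Fs _]]. destruct (orb_launch s0 Hs0) as [_ [F0 _]].
  assert (M : Rabs ((ang (orb s) t - ang (orb s0) t) - (ang (orb s) 0 - ang (orb s0) 0))
              <= e / (T + 1) * (t - 0)).
  { apply (mvt_abs (fun x => ang (orb s) x - ang (orb s0) x)
      (fun x => ang_rate (orb s x) - ang_rate (orb s0 x))); [lra | |].
    - intros x _. apply der_minus; now apply der_ang.
    - intros x Hx. left. apply H; [assumption | assumption | lra]. }
  rewrite !ang_0, !Rminus_0_r in M. replace (PI - PI) with 0 in M by ring.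
  rewrite Rminus_0_r in M. eapply Rle_lt_trans; [exact M |].
  assert (Hy : 0 < e / (T + 1)) by (apply Rdiv_lt_0_compat; lra).
  assert (e / (T + 1) * (T + 1) = e) by (field; lra). nra.
Qed.

(** Positivity of [qq] is not an open condition at the launching time, where [qq]
    vanishes; there [starts_outgoing] takes over from compactness. *)
Lemma outgoing_close s0 T : 1.11 <= s0 <= 2 -> (forall t, 0 < t <= T -> 0 < qq (orb s0 t)) ->
  exists d, 0 < d /\ forall s, 1.11 <= s <= 2 -> Rabs (s - s0) < d ->
    forall t, 0 < t <= T -> 0 < qq (orb s t).
Proof.
  intros Hs0 Hq. destruct (Rle_lt_dec T 0.2) as [HT | HT].
  - exists 1. split; [lra |]. intros s Hs _ t Ht.
    apply (starts_outgoing s _ (orb_launch s Hs)). lra.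
  - destruct (orb_launch s0 Hs0) as [_ [F0 _]].
    destruct (continuity_ab_min (fun t => qq (orb s0 t)) 0.2 T) as [m [Hm Hmr]]; [lra | |].
    { intros; now apply cont_qq. }
    destruct (observable_close qq s0 T (qq (orb s0 m)) loc_lip_qq Hs0) as [d [Hd H]].
    { lra. }
    { apply Hq. lra. }
    exists d. split; [exact Hd |]. intros s Hs Hds t Ht.
    destruct (Rle_lt_dec t 0.2) as [Ht2 | Ht2].
    + apply (starts_outgoing s _ (orb_launch s Hs)). lra.
    + specialize (H s Hs Hds t ltac:(lra)). specialize (Hm t ltac:(lra)).
      apply Rabs_lt_between in H. lra.
Qed.

Lemma first_return_unique u a b : first_return u a -> first_return u b -> a = b.
Proof.
  intros [A1 [A2 A3]] [B1 [B2 B3]]. destruct (Rtotal_order a b) as [H | [H | H]].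
  - specialize (B3 a). lra.
  - exact H.
  - specialize (A3 b). lra.
Qed.

(** Since the return is transversal, its time and the angle swept until then
    depend continuously on the launching point. *)
Lemma return_continuous s0 tau0 e : 1.11 <= s0 <= 2 -> first_return (orb s0) tau0 -> 0 < e ->
  exists d, 0 < d /\ forall s, 1.11 <= s <= 2 -> Rabs (s - s0) < d ->
    exists tau, first_return (orb s) tau /\ Rabs (ang (orb s) tau - ang (orb s0) tau0) < e.
Proof.
  intros Hs0 HR He. assert (HL := orb_launch s0 Hs0).
  destruct (return_transversal s0 _ tau0 HL HR) as [Hr [Lv HA]].
  destruct HR as [Ht0 [Hq0 Hqp]]. destruct HL as [_ [F0 _]].
  assert (D : is_derive (fun t => - qq (orb s0 t)) tau0 (- AA (orb s0 tau0))).
  { apply (is_derive_opp (fun t => qq (orb s0 t))). apply der_qq; [assumption | lra | assumption]. }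
  destruct (rise_after _ _ _ D ltac:(lra) ltac:(lra)) as [x [Hx [Hneg _]]].
  assert (Ca : continuity_pt (ang (orb s0)) tau0) by (eapply deriv_cont, der_ang, F0).
  destruct (Ca (e / 2)) as [y [Hy Hang]]; [lra |].
  set (z := Rmin (Rmin x y) tau0 / 2).
  assert (Hz : 0 < z /\ z < x /\ z < y /\ z < tau0).
  { assert (0 < Rmin (Rmin x y) tau0) by (repeat apply Rmin_glb_lt; assumption).
    pose proof (Rmin_l (Rmin x y) tau0). pose proof (Rmin_r (Rmin x y) tau0).
    pose proof (Rmin_l x y). pose proof (Rmin_r x y). unfold z. lra. }
  assert (Hang' : forall t, Rabs (t - tau0) <= z -> Rabs (ang (orb s0) t - ang (orb s0) tau0) < e / 2).
  { intros t Ht. destruct (Req_dec tau0 t) as [<- | Hne].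
    - replace (_ - _) with 0 by ring. rewrite Rabs_R0. lra.
    - apply (Hang t). split; [split; [exact I | exact Hne] |]. simpl. unfold R_dist. lra. }
  destruct (outgoing_close s0 (tau0 - z) Hs0) as [d1' [Hd1 H1]].
  { intros t Ht. apply Hqp. lra. }
  assert (Hn : qq (orb s0 (tau0 + z)) < 0) by (specialize (Hneg (tau0 + z)); lra).
  destruct (observable_close qq s0 (tau0 + z) (- qq (orb s0 (tau0 + z))) loc_lip_qq Hs0)
    as [d2' [Hd2 H2]]; try lra.
  destruct (angle_close s0 (tau0 + z) (e / 2) Hs0) as [d3 [Hd3 H3]]; try lra.
  exists (Rmin (Rmin d1' d2') d3). split; [repeat apply Rmin_glb_lt; assumption |].
  intros s Hs Hds.
  pose proof (Rmin_l (Rmin d1' d2') d3) as E1. pose proof (Rmin_r (Rmin d1' d2') d3) as E2.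
  pose proof (Rmin_l d1' d2') as E3. pose proof (Rmin_r d1' d2') as E4.
  specialize (H1 s Hs ltac:(lra)). specialize (H2 s Hs ltac:(lra) (tau0 + z) ltac:(lra)).
  specialize (H3 s Hs ltac:(lra)).
  apply Rabs_lt_between in H2.
  destruct (outgoing_or_returns s (orb s) (tau0 + z) (orb_launch s Hs)) as [tau [Htau Hfr]]; try lra.
  exists tau. split; [exact Hfr |].
  assert (Hlow : tau0 - z < tau).
  { destruct Hfr as [R1 [R2 _]]. destruct (Rlt_le_dec (tau0 - z) tau); [assumption |].
    specialize (H1 tau). lra. }
  destruct Hfr as [R1 _].
  specialize (H3 tau ltac:(lra)). specialize (Hang' tau ltac:(apply Rabs_le; lra)).
  replace (ang (orb s) tau - ang (orb s0) tau0) with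
    ((ang (orb s) tau - ang (orb s0) tau) + (ang (orb s0) tau - ang (orb s0) tau0)) by ring.
  eapply Rle_lt_trans; [apply Rabs_triang |]. lra.
Qed.

(** * The angle at the return is unbounded near a parabolic orbit *)

(** Below the escape velocity the speed in the rotating frame, which is almost
    [r], cannot be mostly radial. *)
Lemma slow_far p : level p -> 4 <= rr p -> qq p * qq p <= 11 / 5 * rr p ->
  rho p * rho p / 4 <= ll p * ll p.
Proof.
  intros Lv Hr Hq. assert (E := level_identity p Lv). assert (HU := UU_range p ltac:(lra)).
  assert (0 <= UU p) by nra.
  assert (Hrho : 16 <= rho p) by (rewrite <- rr_sq; nra).
  assert (rr p <= rho p) by (rewrite <- rr_sq; nra).
  assert (0 <= rho p * UU p) by nra.
  unfold Cc, mu in *. nra.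
Qed.

(** By [slow_far] the angular velocity cannot vanish, so it keeps its sign. *)
Lemma lags_persist u a b : flow u -> a <= b ->
  (forall t, a <= t <= b -> level (u t) /\ 4 <= rr (u t) /\ qq (u t) * qq (u t) <= 11 / 5 * rr (u t)) ->
  ll (u a) < 0 -> forall t, a <= t <= b -> ang_rate (u t) <= - / 2.
Proof.
  intros Hu Hab H Ha t Ht.
  assert (Hn : forall x, a <= x <= b -> 16 <= rho (u x) /\ rho (u x) * rho (u x) / 4 <= ll (u x) * ll (u x)).
  { intros x Hx. destruct (H x Hx) as [H1 [H2 H3]]. split; [rewrite <- rr_sq; nra | now apply slow_far]. }
  assert (Hl : ll (u t) < 0).
  { destruct (Rlt_le_dec (ll (u t)) 0) as [|Hp]; [assumption | exfalso].
    destruct (first_zero (fun s => - ll (u s)) a t) as [z [Hz [Hz0 _]]]; try lra.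
    { intros x _. apply continuity_pt_opp. now apply cont_ll. }
    destruct (Hn z ltac:(lra)) as [N1 N2]. replace (ll (u z)) with 0 in N2 by lra. nra. }
  destruct (Hn t Ht) as [N1 N2].
  unfold ang_rate. rewrite Rmax_left by lra. apply div_le_iff; [lra |]. nra.
Qed.

(** Above the escape velocity, so would be the nearby orbits, which return. *)
Lemma parabolic_bound s : 1.11 < s <= 2 -> (forall t, 0 < t -> 0 < qq (orb s t)) ->
  (forall x, 1.11 <= x < s -> exists tau, first_return (orb x) tau) ->
  forall t, 2 <= t -> qq (orb s t) * qq (orb s t) <= 11 / 5 * rr (orb s t).
Proof.
  intros Hs Hp Hret t Ht. apply Rnot_lt_le. intros Hlt.
  (* the escape criterion, squared so that it becomes a polynomial *)
  set (g := fun p => (qq p * qq p) * (qq p * qq p) + (- (121 / 25)) * rho p).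
  assert (Hg : loc_lip g).
  { apply loc_lip_plus.
    - apply loc_lip_mult; apply loc_lip_mult; apply loc_lip_qq.
    - apply loc_lip_mult; [apply loc_lip_const | apply loc_lip_rho]. }
  assert (Hg0 : 0 < g (orb s t)).
  { unfold g. rewrite <- rr_sq. pose proof (rr_pos (orb s t)). nra. }
  destruct (observable_close g s t (g (orb s t)) Hg) as [d [Hd H]]; try lra.
  destruct (outgoing_close s t) as [d' [Hd' H']]; [lra | intros; apply Hp; lra |].
  set (x := Rmax 1.11 (s - Rmin d d' / 2)).
  assert (Hm : 0 < Rmin d d') by (now apply Rmin_glb_lt).
  pose proof (Rmin_l d d') as M1. pose proof (Rmin_r d d') as M2.
  assert (X1 : 1.11 <= x) by apply Rmax_l. assert (X2 : s - Rmin d d' / 2 <= x) by apply Rmax_r.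
  assert (X3 : x < s) by (apply Rmax_lub_lt; lra).
  assert (Xd : Rabs (x - s) < Rmin d d') by (rewrite Rabs_left; lra).
  specialize (H x ltac:(lra) ltac:(lra) t ltac:(lra)). specialize (H' x ltac:(lra) ltac:(lra)).
  apply Rabs_lt_between in H.
  assert (Hgx : 0 < g (orb x t)) by lra.
  assert (HL := orb_launch x ltac:(lra)). assert (HL' := HL). destruct HL' as [_ [Fx Ix]].
  assert (Hge : forall y, 0 <= y <= t -> 0 <= qq (orb x y)).
  { intros y Hy. destruct (Req_dec y 0) as [-> |]; [rewrite Ix, init_qq; lra |].
    left. apply H'. lra. }
  assert (O := outgoing _ Fx 0 t ltac:(lra) ltac:(rewrite Ix, init_rr; lra)
    ltac:(rewrite Ix; apply init_level; lra) Hge t ltac:(lra)).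
  assert (Hr : 1.5 <= rr (orb x t)).
  { apply Rle_trans with (rr (orb x 2)).
    - apply (clears_early x _ HL). intros; apply Hge; lra.
    - apply rr_mono; [assumption | lra | intros; apply Hge; lra]. }
  assert (Hesc : 11 / 5 * rr (orb x t) < qq (orb x t) * qq (orb x t)).
  { unfold g in Hgx. rewrite <- rr_sq in Hgx.
    assert (0 <= qq (orb x t) * qq (orb x t)) by apply Rle_0_sqr. nra. }
  destruct (Hret x ltac:(lra)) as [tau [T1 [T2 T3]]].
  destruct (Rle_lt_dec tau t) as [Hle | Hgt].
  - specialize (H' tau ltac:(lra)). lra.
  - assert (0 < qq (orb x tau)); [| lra].
    apply (escape _ Fx t); [lra | apply O | apply H'; lra | exact Hesc | lra].
Qed.

(** A parabolic orbit ends up lagging behind the rotating frame: otherwise its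
    centrifugal force would accelerate it above the escape velocity. *)
Lemma eventually_lags s : 1.11 <= s <= 2 -> (forall t, 0 < t -> 0 < qq (orb s t)) ->
  (forall t, 2 <= t -> qq (orb s t) * qq (orb s t) <= 11 / 5 * rr (orb s t)) ->
  exists a, 2 <= a /\ 5 <= rr (orb s a) /\ ll (orb s a) < 0.
Proof.
  intros Hs Hp Hpar. assert (HL := orb_launch s Hs).
  destruct (unbounded s _ HL Hp 5) as [a [Ha Hra]].
  assert (LO := launch_outgoing s _ HL Hp).
  destruct HL as [_ [Fs _]].
  apply NNPP. intros Hno.
  assert (Hr : forall t, a <= t -> 5 <= rr (orb s t)).
  { intros t Ht. apply Rle_trans with (rr (orb s a)); [exact Hra |].
    apply rr_mono; [assumption | lra | intros; apply LO; lra]. }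
  assert (Hl : forall t, a <= t -> 0 <= ll (orb s t)).
  { intros t Ht. apply Rnot_lt_le. intros Hlt. apply Hno. exists t.
    split; [lra |]. split; [now apply Hr | exact Hlt]. }
  assert (Hqs : forall t, a <= t -> qq (orb s t) <= rho (orb s t) / 5).
  { intros t Ht. specialize (Hr t Ht). specialize (Hpar t ltac:(lra)). rewrite <- rr_sq.
    apply Rsqr_incr_0_var; [| nra]. unfold Rsqr.
    set (r := rr (orb s t)) in *. assert (125 <= r * r * r) by nra. nra. }
  set (b := a + rho (orb s a)).
  assert (Hb : a < b) by (unfold b; assert (0 < rho (orb s a)); [rewrite <- rr_sq; nra | lra]).
  assert (M : (rho (orb s b) - qq (orb s b)) - (rho (orb s a) - qq (orb s a)) <= -1 * (b - a)).
  { apply (mvt_le (fun t => rho (orb s t) - qq (orb s t))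
      (fun t => 2 * qq (orb s t) - AA (orb s t))); [lra | |].
    - intros t Ht. destruct (LO t ltac:(lra)) as [_ [L2 L3]].
      apply der_minus; [now apply der_rho | apply der_qq; [assumption | lra | assumption]].
    - intros t Ht. specialize (Hl t ltac:(lra)). specialize (Hr t ltac:(lra)).
      specialize (Hqs t ltac:(lra)).
      assert (HU := UU_range (orb s t) ltac:(lra)). assert (He := ee_range (orb s t) ltac:(lra)).
      apply Rabs_le_between in He.
      assert (0 <= UU (orb s t)) by nra. assert (- 0.01 <= ee (orb s t)) by nra.
      assert (25 <= rho (orb s t)) by (rewrite <- rr_sq; nra).
      unfold AA, Gm, Cc, mu. lra. }
  specialize (Hqs b ltac:(lra)) as Hqb.
  destruct (LO a ltac:(lra)) as [La _].
  assert (25 <= rho (orb s b)) by (specialize (Hr b ltac:(lra)); rewrite <- rr_sq; nra).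
  unfold b in *. lra.
Qed.

(** The orbit launched from [s] has turned below the angle [N - 1] at some late
    time [b]. A nearby returning orbit has turned below [N] by then, and from
    there to its apocentre it keeps lagging behind the rotating frame. *)
Lemma winding s : 1.11 < s <= 2 -> (forall t, 0 < t -> 0 < qq (orb s t)) ->
  (forall x, 1.11 <= x < s -> exists tau, first_return (orb x) tau) ->
  forall N, exists x tau, 1.11 <= x < s /\ first_return (orb x) tau /\ ang (orb x) tau <= N.
Proof.
  intros Hs Hp Hret N.
  assert (Hpar := parabolic_bound s Hs Hp Hret).
  assert (HL := orb_launch s ltac:(lra)). assert (LO := launch_outgoing s _ HL Hp).
  destruct (eventually_lags s ltac:(lra) Hp Hpar) as [a [Ha [Hra Hla]]].
  destruct HL as [_ [Fs _]].
  assert (Hr : forall t, a <= t -> 5 <= rr (orb s t)).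
  { intros t Ht. apply Rle_trans with (rr (orb s a)); [exact Hra |].
    apply rr_mono; [assumption | lra | intros; apply LO; lra]. }
  assert (Hrate : forall t, a <= t -> ang_rate (orb s t) <= - / 2).
  { intros t Ht. apply (lags_persist (orb s) a t); try assumption; try lra.
    intros x Hx. split; [apply LO; lra |]. split; [specialize (Hr x); lra | apply Hpar; lra]. }
  set (b := a + 2 * (Rabs (ang (orb s) a) + Rabs N + 1)).
  assert (Hb : a + 2 <= b).
  { unfold b. pose proof (Rabs_pos (ang (orb s) a)). pose proof (Rabs_pos N). lra. }
  assert (Hangb : ang (orb s) b <= N - 1).
  { assert (M : ang (orb s) b - ang (orb s) a <= - / 2 * (b - a)).
    { apply (mvt_le (ang (orb s)) (fun t => ang_rate (orb s t))); [lra | |].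
      - intros; now apply der_ang.
      - intros; apply Hrate; lra. }
    pose proof (Rle_abs (ang (orb s) a)). pose proof (Rabs_maj2 N). unfold b in *. lra. }
  assert (Hlb : ll (orb s b) < 0).
  { specialize (Hrate b ltac:(lra)). unfold ang_rate in Hrate.
    assert (1 <= Rmax (rho (orb s b)) 1) by apply Rmax_r.
    apply Rnot_le_lt. intros Hle.
    assert (0 <= ll (orb s b) / Rmax (rho (orb s b)) 1) by (apply Rdiv_le_0_compat; lra). lra. }
  assert (Hrb : 25 <= rho (orb s b)) by (specialize (Hr b ltac:(lra)); rewrite <- rr_sq; nra).
  destruct (outgoing_close s b) as [d1' [D1 H1]]; [lra | intros; apply Hp; lra |].
  destruct (angle_close s b 1) as [d2' [D2 H2]]; try lra.
  destruct (observable_close ll s b (- ll (orb s b)) loc_lip_ll) as [d3 [D3 H3]]; try lra.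
  destruct (observable_close rho s b 1 loc_lip_rho) as [d4 [D4 H4]]; try lra.
  set (d := Rmin (Rmin d1' d2') (Rmin d3 d4)).
  assert (Hd : 0 < d) by (repeat apply Rmin_glb_lt; assumption).
  assert (Hdd : d <= d1' /\ d <= d2' /\ d <= d3 /\ d <= d4).
  { pose proof (Rmin_l (Rmin d1' d2') (Rmin d3 d4)). pose proof (Rmin_r (Rmin d1' d2') (Rmin d3 d4)).
    pose proof (Rmin_l d1' d2'). pose proof (Rmin_r d1' d2').
    pose proof (Rmin_l d3 d4). pose proof (Rmin_r d3 d4). unfold d. lra. }
  set (x := Rmax 1.11 (s - d / 2)).
  assert (X1 : 1.11 <= x) by apply Rmax_l. assert (X2 : s - d / 2 <= x) by apply Rmax_r.
  assert (X3 : x < s) by (apply Rmax_lub_lt; lra).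
  assert (Xd : Rabs (x - s) < d) by (rewrite Rabs_left; lra).
  specialize (H1 x ltac:(lra) ltac:(lra)).
  specialize (H2 x ltac:(lra) ltac:(lra) b ltac:(lra)).
  specialize (H3 x ltac:(lra) ltac:(lra) b ltac:(lra)).
  specialize (H4 x ltac:(lra) ltac:(lra) b ltac:(lra)).
  apply Rabs_lt_between in H2, H3, H4.
  destruct (Hret x ltac:(lra)) as [tau Hfr]. exists x, tau.
  split; [lra |]. split; [exact Hfr |].
  destruct Hfr as [T1 [T2 T3]].
  assert (Hbt : b < tau).
  { apply Rnot_le_lt. intros Hle. specialize (H1 tau ltac:(lra)). lra. }
  assert (HLx := orb_launch x ltac:(lra)). assert (HLx' := HLx). destruct HLx' as [_ [Fx Ix]].
  assert (Hge : forall y, 0 <= y <= tau -> 0 <= qq (orb x y)).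
  { intros y Hy. destruct (Req_dec y 0) as [-> |]; [rewrite Ix, init_qq; lra |].
    destruct (Req_dec y tau) as [-> |]; [lra |]. left. apply T3. lra. }
  assert (O := outgoing _ Fx 0 tau ltac:(lra) ltac:(rewrite Ix, init_rr; lra)
    ltac:(rewrite Ix; apply init_level; lra) Hge).
  assert (Hrx : forall y, b <= y <= tau -> 4 <= rr (orb x y)).
  { intros y Hy. apply Rle_trans with (rr (orb x b)).
    - apply Rsqr_incr_0_var; [| apply rr_pos]. unfold Rsqr. rewrite rr_sq. lra.
    - apply rr_mono; [assumption | lra | intros; apply Hge; lra]. }
  assert (HR : forall y, b <= y <= tau -> ang_rate (orb x y) <= - / 2).
  { intros y Hy. apply (lags_persist (orb x) b tau); try assumption; try lra.
    intros z Hz. destruct (O z ltac:(lra)) as [_ Lz]. specialize (Hrx z Hz).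
    split; [exact Lz |]. split; [exact Hrx |].
    destruct (Req_dec z tau) as [-> | Hne]; [rewrite T2; lra |].
    (* an orbit that returns stays below the escape velocity *)
    apply Rnot_lt_le. intros Hesc.
    assert (0 < qq (orb x tau)); [| lra].
    apply (escape _ Fx z); [lra | exact Lz | apply T3; lra | exact Hesc | lra]. }
  assert (M : ang (orb x) tau - ang (orb x) b <= - / 2 * (tau - b)).
  { apply (mvt_le (ang (orb x)) (fun t => ang_rate (orb x t))); [lra | | exact HR].
    intros; now apply der_ang. }
  lra.
Qed.

Definition return_time (s : R) : R := epsilon (inhabits 0) (first_return (orb s)).

Definition return_angle (s : R) : R := ang (orb s) (return_time s).

Lemma return_angle_eq s tau : first_return (orb s) tau -> return_angle s = ang (orb s) tau.
Proof.
  intros H. unfold return_angle. f_equal. apply (first_return_unique (orb s)); [| exact H].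
  unfold return_time. apply epsilon_spec. now exists tau.
Qed.

(** The launching points from [1.11] up to the first parabolic one sweep out all
    return angles below that of [1.11]. *)
Lemma return_angles_onto y : y < return_angle 1.11 ->
  exists s tau, 1.11 <= s <= 2 /\ first_return (orb s) tau /\ ang (orb s) tau = y.
Proof.
  intros Hy.
  set (ret := fun s => exists tau, first_return (orb s) tau).
  assert (R0 : ret 1.11) by (apply returns_from_111, orb_launch; lra).
  set (E := fun z => 1.11 <= z <= 2 /\ forall s, 1.11 <= s <= z -> ret s).
  assert (E0 : E 1.11).
  { split; [lra |]. intros s Hs. replace s with 1.11 by lra. exact R0. }
  destruct (completeness E) as [z [Hub Hlub]].
  { exists 2. intros z [Hz _]. lra. }
  { now exists 1.11. }
  assert (Hz1 : 1.11 <= z) by (now apply Hub).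
  assert (Hz2 : z <= 2) by (apply Hlub; intros w [Hw _]; lra).
  assert (Hlt : forall s, 1.11 <= s < z -> ret s).
  { intros s Hs. apply NNPP. intros Hn. assert (z <= s); [| lra].
    apply Hlub. intros w [Hw Hr]. apply Rnot_lt_le. intros Hl. apply Hn, Hr. lra. }
  assert (Hnz : ~ ret z).
  { intros [tau Hfr].
    assert (Hz3 : z < 2).
    { destruct (Rle_lt_or_eq_dec z 2 Hz2) as [|Heq]; [assumption | exfalso].
      rewrite Heq in Hfr. destruct Hfr as [T1 [T2 _]].
      assert (HE := escapes_from_2 (orb 2) (orb_launch 2 ltac:(lra)) tau T1). lra. }
    destruct (return_continuous z tau 1 ltac:(lra) Hfr ltac:(lra)) as [d [Hd H]].
    set (w := Rmin 2 (z + d / 2)).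
    assert (W1 : w <= 2) by apply Rmin_l. assert (W2 : w <= z + d / 2) by apply Rmin_r.
    assert (W3 : z < w) by (apply Rmin_glb_lt; lra).
    assert (w <= z); [| lra].
    apply Hub. split; [lra |]. intros s Hs.
    destruct (Rlt_le_dec s z); [apply Hlt; lra |].
    destruct (H s ltac:(lra)) as [t [Ht _]]; [rewrite Rabs_pos_eq; lra |]. now exists t. }
  assert (Hz3 : 1.11 < z).
  { destruct (Rle_lt_or_eq_dec 1.11 z Hz1) as [|Heq]; [assumption | exfalso].
    apply Hnz. rewrite <- Heq. exact R0. }
  assert (Hp : forall t, 0 < t -> 0 < qq (orb z t)).
  { intros t Ht. apply Rnot_le_lt. intros Hn.
    destruct (outgoing_or_returns z (orb z) t (orb_launch z ltac:(lra)) Ht Hn) as [tau [_ F]].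
    apply Hnz. now exists tau. }
  destruct (winding z ltac:(lra) Hp Hlt (y - 1)) as [x [tau [Hx [Hfr Hang]]]].
  assert (Hx1 : 1.11 < x).
  { destruct (Req_dec x 1.11) as [Heq |]; [exfalso | lra].
    rewrite <- (return_angle_eq x tau Hfr), Heq in Hang. lra. }
  set (g := fun s => y - return_angle (Rmax 1.11 s)).
  destruct (Ranalysis5.IVT_interv g 1.11 x) as [s [Hs Hgs]].
  - intros a Ha e He.
    destruct (Hlt a ltac:(lra)) as [ta Hta].
    destruct (return_continuous a ta e ltac:(lra) Hta He) as [d [Hd H]].
    exists (Rmin d (2 - a)). split; [apply Rmin_glb_lt; lra |].
    intros w [_ Hw]. simpl in *. unfold R_dist in *.
    pose proof (Rmin_l d (2 - a)). pose proof (Rmin_r d (2 - a)).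
    assert (Hw2 : w < 2) by (apply Rabs_lt_between in Hw; lra).
    assert (M1 : 1.11 <= Rmax 1.11 w <= 2) by (split; [apply Rmax_l | apply Rmax_lub; lra]).
    assert (M2 : Rabs (Rmax 1.11 w - a) < d).
    { apply Rabs_lt_between in Hw. apply Rabs_lt_between. unfold Rmax. destruct Rle_dec; lra. }
    destruct (H _ M1 M2) as [tw [Htw Hc]].
    unfold g. rewrite (Rmax_right 1.11 a) by lra.
    rewrite (return_angle_eq _ _ Htw), (return_angle_eq _ _ Hta).
    rewrite Rabs_minus_sym.
    replace (y - ang (orb a) ta - (y - ang (orb (Rmax 1.11 w)) tw)) with
      (ang (orb (Rmax 1.11 w)) tw - ang (orb a) ta) by ring. exact Hc.
  - exact Hx1.
  - unfold g. rewrite Rmax_left by lra. lra.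
  - unfold g. rewrite Rmax_right by lra. rewrite (return_angle_eq _ _ Hfr). lra.
  - unfold g in Hgs. rewrite Rmax_right in Hgs by lra.
    destruct (Hlt s ltac:(lra)) as [ts Hts]. exists s, ts.
    split; [lra |]. split; [exact Hts |].
    rewrite (return_angle_eq _ _ Hts) in Hgs. lra.
Qed.


(** * From symmetric returns to periodic orbits *)

Lemma Rsym_rr p : rr (Rsym p) = rr p.
Proof. unfold rr, rho, Rsym; simpl. f_equal. ring. Qed.

Lemma Rsym_level p : level p -> level (Rsym p).
Proof.
  unfold level, UU, d1, d2, r1, r2, rho, Rsym; simpl.
  replace (- py p * (- py p * 1)) with (py p * (py p * 1)) by ring.
  intros H. lra.
Qed.

Lemma Omega_derivatives p : 0 < d1 p -> 0 < d2 p ->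
  Omega_x mu (px p) (py p) =
    px p - (1 - mu) / d1 p ^ 3 * (px p + mu) - mu / d2 p ^ 3 * (px p - 1 + mu) /\
  Omega_y mu (px p) (py p) =
    py p - ((1 - mu) / d1 p ^ 3 + mu / d2 p ^ 3) * py p.
Proof.
  intros H1 H2. split; apply is_derive_unique.
  - assert (X := der_id (px p)). assert (Y := der_const (py p) (px p)).
    assert (I1 := der_inv_d (fun z => r1 mu z (py p)) (fun z => z + mu) (fun _ => py p)
      (fun _ => 1) (fun _ => 0) (px p)).
    assert (I2 := der_inv_d (fun z => r2 mu z (py p)) (fun z => z - 1 + mu) (fun _ => py p)
      (fun _ => 1) (fun _ => 0) (px p)).
    unfold Omega, Rdiv. eapply der_eq.
    + apply der_plus; [| apply der_const].
      apply der_plus; [apply der_plus |].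
      * apply der_mult; [| apply der_const].
        apply der_plus; [| apply der_const].
        apply (is_derive_ext (fun z => z * z)); [intros; simpl; ring |].
        apply der_mult; apply der_id.
      * apply der_mult; [apply der_const | apply I1]; try assumption.
        -- intros s. unfold r1. f_equal. ring.
        -- eapply der_eq; [apply der_plus; [exact X | apply der_const] | ring].
      * apply der_mult; [apply der_const | apply I2]; try assumption.
        -- intros s. unfold r2. f_equal. ring.
        -- eapply der_eq; [apply der_plus; [apply der_minus; [exact X |] |]; apply der_const | ring].
    + cbv beta. fold (d1 p). fold (d2 p). field. lra.
  - assert (X := der_id (py p)).
    assert (I1 := der_inv_d (fun z => r1 mu (px p) z) (fun _ => px p + mu) (fun z => z)
      (fun _ => 0) (fun _ => 1) (py p)).
    assert (I2 := der_inv_d (fun z => r2 mu (px p) z) (fun _ => px p - 1 + mu) (fun z => z)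
      (fun _ => 0) (fun _ => 1) (py p)).
    unfold Omega, Rdiv. eapply der_eq.
    + apply der_plus; [| apply der_const].
      apply der_plus; [apply der_plus |].
      * apply der_mult; [| apply der_const].
        apply der_plus; [apply der_const |].
        apply (is_derive_ext (fun z => z * z)); [intros; simpl; ring |].
        apply der_mult; apply der_id.
      * apply der_mult; [apply der_const | apply I1]; try assumption.
        -- intros s. unfold r1. f_equal. ring.
        -- apply der_const.
      * apply der_mult; [apply der_const | apply I2]; try assumption.
        -- intros s. unfold r2. f_equal. ring.
        -- apply der_const.
    + cbv beta. fold (d1 p). fold (d2 p). field. lra.
Qed.

Section SymmetricReturn.

Context (s tau : R) (k : Z) (Hs : 1.11 <= s <= 2) (Hfr : first_return (orb s) tau)
  (Hang : ang (orb s) tau = IZR k * PI).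

Let u := orb s.

Lemma arc t : 0 <= t <= tau -> s <= rr (u t) /\ level (u t).
Proof.
  assert (HL := orb_launch s Hs). destruct HL as [_ [Fu I0]].
  destruct Hfr as [T1 [T2 T3]].
  assert (Hge : forall y, 0 <= y <= tau -> 0 <= qq (u y)).
  { intros y Hy. unfold u. destruct (Req_dec y 0) as [-> |]; [rewrite I0, init_qq; lra |].
    destruct (Req_dec y tau) as [-> |]; [lra |]. left. apply T3. lra. }
  assert (O := outgoing _ Fu 0 tau ltac:(lra) ltac:(rewrite I0, init_rr; lra)
    ltac:(rewrite I0; apply init_level; lra) Hge t).
  rewrite I0, init_rr in O by lra. exact O.
Qed.

(** The angle puts the apocentre on the axis, and there [qq = 0] makes the
    velocity perpendicular to it. *)
Lemma return_symmetric : Rsym (u tau) = u tau.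
Proof.
  assert (HL := orb_launch s Hs).
  destruct Hfr as [T1 [T2 T3]].
  destruct (polar s u tau HL ltac:(lra)) as [Px Py].
  { intros t Ht. destruct (arc t Ht) as [A _]. rewrite <- rr_sq. nra. }
  destruct (arc tau ltac:(lra)) as [A _].
  assert (Hsin : sin (ang u tau) = 0) by (apply sin_eq_0_1; now exists k).
  assert (HSC := sin2_cos2 (ang u tau)). unfold Rsqr in HSC.
  rewrite Hsin in HSC, Py. rewrite Rmult_0_r in Py.
  assert (Hx : px (u tau) <> 0).
  { intros E. rewrite E in Px.
    assert (cos (ang u tau) = 0).
    { apply (Rmult_eq_reg_l (rr (u tau))); lra. }
    rewrite H in HSC. lra. }
  assert (Hv : vx (u tau) = 0).
  { unfold qq in T2. fold u in T2. rewrite Py in T2.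
    apply (Rmult_eq_reg_l (px (u tau))); lra. }
  unfold Rsym. destruct (u tau) as [x y v w]; simpl in *. f_equal; lra.
Qed.

Lemma reflect_0 t : u t = Rsym (u (- t)).
Proof.
  destruct (orb_launch s Hs) as [_ [Fu I0]].
  rewrite <- Rminus_0_l.
  apply (flow_unique u (fun t => Rsym (u (0 - t))) Fu (flow_reverse u 0 Fu)).
  rewrite Rminus_0_r. unfold u. rewrite I0. unfold Rsym, init; simpl. f_equal; ring.
Qed.

Lemma reflect_tau t : u (t + tau) = Rsym (u (tau - t)).
Proof.
  destruct (orb_launch s Hs) as [_ [Fu I0]].
  apply (flow_unique (fun t => u (t + tau)) (fun t => Rsym (u (tau - t)))
    (flow_shift u tau Fu) (flow_reverse u tau Fu)).
  rewrite Rplus_0_l, Rminus_0_r. symmetry. apply return_symmetric.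
Qed.

(** Composing the two reflections gives the translation by [2 * tau]. *)
Lemma period t : u (t + 2 * tau) = u t.
Proof.
  replace (t + 2 * tau) with ((t + tau) + tau) by ring.
  rewrite reflect_tau. replace (tau - (t + tau)) with (- t) by ring.
  symmetry. apply reflect_0.
Qed.

Lemma periods_nat (n : nat) t : u (t + INR n * (2 * tau)) = u t.
Proof.
  induction n as [|n IH].
  - simpl. f_equal. ring.
  - rewrite S_INR. replace (t + (INR n + 1) * (2 * tau)) with ((t + INR n * (2 * tau)) + 2 * tau) by ring.
    rewrite period. exact IH.
Qed.

(** Reflections fold the whole orbit onto the arc from launch to first return. *)
Lemma fold_to_arc t : exists t', 0 <= t' <= tau /\ (u t = u t' \/ u t = Rsym (u t')).
Proof.
  assert (Ht : 0 < 2 * tau) by (destruct Hfr; lra).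
  assert (Hpos : forall t, 0 <= t -> exists t', 0 <= t' <= tau /\ (u t = u t' \/ u t = Rsym (u t'))).
  { clear t. intros t Hge.
    assert (Hq : 0 <= t / (2 * tau)) by (apply Rdiv_le_0_compat; lra).
    destruct (nfloor_ex _ Hq) as [n [Hn1 Hn2]].
    set (x := t - INR n * (2 * tau)).
    assert (Hx : 0 <= x < 2 * tau).
    { assert (E : t = t / (2 * tau) * (2 * tau)) by (field; lra).
      unfold x. split; nra. }
    assert (E : u t = u x).
    { rewrite <- (periods_nat n x). f_equal. unfold x. ring. }
    rewrite E. destruct (Rle_lt_dec x tau).
    - exists x. split; [lra |]. now left.
    - exists (2 * tau - x). split; [lra |]. right.
      replace x with ((x - tau) + tau) at 1 by ring. rewrite reflect_tau.
      f_equal. f_equal. ring. }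
  destruct (Rle_lt_dec 0 t) as [|Hn]; [now apply Hpos |].
  destruct (Hpos (- t) ltac:(lra)) as [t' [Ht' H]]. exists t'. split; [exact Ht' |].
  rewrite (reflect_0 t). destruct H as [-> | ->]; [now right | left].
  unfold Rsym; destruct (u t'); simpl. f_equal; ring.
Qed.

Lemma everywhere t : s <= rr (u t) /\ level (u t).
Proof.
  destruct (fold_to_arc t) as [t' [Ht' H]]. destruct (arc t' Ht') as [A B].
  destruct H as [-> | ->]; [now split |].
  rewrite Rsym_rr. split; [exact A | now apply Rsym_level].
Qed.

Definition orbit_curve : curve := mkCurve (fun _ => True) u.

Lemma curve_solution : solution mu orbit_curve.
Proof.
  split.
  - split; [now exists 0 |]. split; [apply open_true |]. now intros.
  - intros t _. destruct (everywhere t) as [Hr _].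
    destruct (clear_dist (u t) ltac:(lra)) as [D1 D2].
    destruct (clear_k (u t) ltac:(lra)) as [K1 K2].
    destruct (Omega_derivatives (u t) ltac:(lra) ltac:(lra)) as [Ox Oy].
    destruct (orb_launch s Hs) as [_ [Fu _]]. destruct (Fu t) as [A [B [C D]]].
    simpl. split; [split; fold (d1 (u t)); fold (d2 (u t)); lra |].
    split; [exact A |]. split; [exact B |]. split.
    + eapply der_eq; [exact C |]. fold u. unfold accx. rewrite K1, K2, Ox. ring.
    + eapply der_eq; [exact D |]. fold u. unfold accy. rewrite K1, K2, Oy. ring.
Qed.

Lemma curve_orbit : orbit mu 3.03 orbit_curve.
Proof.
  split.
  - split; [apply curve_solution |]. now intros.
  - intros t _. simpl. destruct (everywhere t) as [Hr Lv].
    destruct (clear_dist (u t) ltac:(lra)) as [D1 D2]. split.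
    + split; fold (d1 (u t)); fold (d2 (u t)); lra.
    + unfold Omega. fold (d1 (u t)). fold (d2 (u t)).
      unfold level, UU, rho, Cc in Lv. simpl. lra.
Qed.

Lemma curve_periodic : periodic orbit_curve.
Proof.
  destruct Hfr as [T1 [T2 T3]]. split.
  - exists (2 * tau). split; [lra |]. intros t _. split; [exact I |]. apply period.
  - exists tau, (tau / 2). split; [exact I |]. split; [exact I |]. simpl. intros E.
    specialize (T3 (tau / 2) ltac:(lra)). fold u in T2, T3. rewrite E in T2. lra.
Qed.

Lemma curve_symmetric : R_symmetric orbit_curve.
Proof.
  intros p. split.
  - intros [t [_ ->]]. exists (u (- t)). split; [now exists (- t) |]. apply reflect_0.
  - intros [q [[t [_ ->]] ->]]. exists (- t). split; [exact I |]. simpl.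
    rewrite (reflect_0 (- t)), Ropp_involutive. reflexivity.
Qed.

Lemma curve_pericentre : (exists p, image orbit_curve p /\ rr p = s) /\
  forall p, image orbit_curve p -> s <= rr p.
Proof.
  destruct (orb_launch s Hs) as [_ [_ I0]]. split.
  - exists (u 0). split; [now exists 0 |]. unfold u. rewrite I0. apply init_rr. lra.
  - intros p [t [_ ->]]. apply everywhere.
Qed.

End SymmetricReturn.

Theorem mainTheorem6 :
  exists o : nat -> curve,
    (forall n : nat,
       orbit 0.0009537 3.03 (o n) /\ periodic (o n) /\ R_symmetric (o n)) /\
    (forall m n : nat, m <> n -> geometrically_different (o m) (o n)).
Proof.
  destruct (INR_archimed PI (- return_angle 1.11) PI_RGT_0) as [n0 Hn0].
  assert (H : forall n : nat, exists s, 1.11 <= s <= 2 /\ exists tau,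
    first_return (orb s) tau /\ ang (orb s) tau = IZR (- Z.of_nat (n0 + n)) * PI).
  { intros n. destruct (return_angles_onto (IZR (- Z.of_nat (n0 + n)) * PI)) as [s [tau [H1 H2]]].
    - rewrite opp_IZR, <- INR_IZR_INZ, plus_INR.
      assert (0 <= INR n * PI) by (apply Rmult_le_pos; [apply pos_INR | left; apply PI_RGT_0]).
      lra.
    - exists s. split; [exact H1 |]. exists tau. exact H2. }
  set (S := fun n => proj1_sig (constructive_indefinite_description _ (H n))).
  assert (HS : forall n, 1.11 <= S n <= 2 /\ exists tau,
    first_return (orb (S n)) tau /\ ang (orb (S n)) tau = IZR (- Z.of_nat (n0 + n)) * PI).
  { intros n. exact (proj2_sig (constructive_indefinite_description _ (H n))). }
  exists (fun n => orbit_curve (S n)). split.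
  - intros n. destruct (HS n) as [H1 [tau [H2 H3]]].
    split; [exact (curve_orbit _ _ _ H1 H2 H3) |].
    split; [exact (curve_periodic _ _ _ H1 H2 H3) | exact (curve_symmetric _ H1)].
  - intros m n Hmn Heq.
    destruct (HS m) as [M1 [tm [M2 M3]]]. destruct (HS n) as [N1 [tn [N2 N3]]].
    destruct (curve_pericentre _ _ _ M1 M2 M3) as [[p [Pm Rm]] Bm].
    destruct (curve_pericentre _ _ _ N1 N2 N3) as [[q [Qn Rn]] Bn].
    (* equal images have equal pericentre distances, hence equal return angles *)
    assert (E : S m = S n).
    { apply Rle_antisym.
      - rewrite <- Rn. apply Bm, Heq, Qn.
      - rewrite <- Rm. apply Bn, Heq, Pm. }
    rewrite E in M2, M3. rewrite (first_return_unique _ _ _ M2 N2), N3 in M3.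
    apply Rmult_eq_reg_r in M3; [| assert (HPI := PI_RGT_0); lra].
    apply eq_IZR in M3. lia.
Qed.
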